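(* Let $(C,F,D,G)$ be the data of a hybrid inclusion on $\mathbb R^n$ satisfying the Hybrid Basic Conditions. Then each (bounded, complete) vanishing inflation solution of the hybrid inclusion is an asymptotic solution of the hybrid inclusion.
   Context: $\mathbb B$ is the closed unit ball. A hybrid time domain is the union of a nondecreasing sequence of compact hybrid time domains, i.e. sets $\bigcup_{i=0}^{J-1}[t_i,t_{i+1}]\times\{i\}$ with $J\ge1$, $0=t_0\le\dots\le t_J$. A hybrid curve is a function $\phi:\mathrm{dom}\,\phi\to\mathbb R^n$ on a hybrid time domain such that $t\mapsto\phi(t,j)$ is continuous on $[t,t']$ whenever $(t,j),(t',j)\in\mathrm{dom}\,\phi$, $t<t'$; it is a hybrid arc if moreover these functions are absolutely continuous; it is complete if its domain is unbounded. The tail $\phi^{(s,i)}$, $(s,i)\in\mathrm{dom}\,\phi$, has domain $\{(t,j)\in[0,\infty)^2:(s+t,i+j)\in\mathrm{dom}\,\phi\}$ and values $\phi(s+t,i+j)$. Graphical convergence of mappings (viewed as set-valued mappings $\mathbb R^2\rightrightarrows\mathbb R^n$, empty-valued off their domains) means Painlevé–Kuratowski set convergence of their graphs in $\mathbb R^{n+2}$. Hybrid inclusion with data $(C,F,D,G)$: $x\in C,\ \dot x\in F(x)$; $x\in D,\ x^+\in G(x)$, with $C,D\subset\mathbb R^n$, $F,G:\mathbb R^n\rightrightarrows\mathbb R^n$. Hybrid Basic Conditions: $C,D$ closed; $F,G$ outer semicontinuous and locally bounded; $F(x)$ nonempty and convex for all $x\in C$; $G(x)$ nonempty for all $x\in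 D$. A solution is a hybrid arc $\phi$ with $\phi(0,0)\in C\cup D$ such that: whenever $[t,t']\times\{j\}\subset\mathrm{dom}\,\phi$ with $t<t'$, $\phi(r,j)\in C$ and $\dot\phi(r,j)\in F(\phi(r,j))$ for almost all $r\in[t,t']$; whenever $(t,j),(t,j+1)\in\mathrm{dom}\,\phi$, $\phi(t,j)\in D$ and $\phi(t,j+1)\in G(\phi(t,j))$. $\mathcal S_{\mathcal H}$ is the set of all solutions. An asymptotic solution is a hybrid curve $\phi$ that is bounded, has unbounded domain, and such that for every graphically convergent sequence of tails $\phi^{(t_n,j_n)}$ with $(t_n,j_n)\in\mathrm{dom}\,\phi$, $t_n+j_n\to\infty$, the graphical limit is a complete element of $\mathcal S_{\mathcal H}$. For $\varepsilon>0$ the $\varepsilon$-inflated system is the hybrid inclusion with data $C_\varepsilon=C+\varepsilon\mathbb B$, $F_\varepsilon(x)=\overline{\mathrm{co}}\,F((x+\varepsilon\mathbb B)\cap C)+\varepsilon\mathbb B$ for $x\in C_\varepsilon$, $D_\varepsilon=D+\varepsilon\mathbb B$, $G_\varepsilon(x)=G((x+\varepsilon\mathbb B)\cap D)+\varepsilon\mathbb B$ for $x\in D_\varepsilon$. For a complete, bounded hybrid arc $\psi$, $\mathcal P(\psi)$ is the class of functions $\chi:\mathrm{dom}\,\chi\to\mathbb R^n$ such that (i) $\mathrm{dom}\,\chi=\{(s,i,t,j):(s,i),(t,j)\in\mathrm{dom}\,\psi,\ s+i\le t+j\}$; (ii) if $(s,i,t_1,j),(s,i,t_2,j)\in\mathrm{dom}\,\chi$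 with $t_2>t_1$, then $t\mapsto\chi(s,i,t,j)$ is absolutely continuous on $[t_1,t_2]$; (iii) for each $\tau>0$, $\lim_{s+i\to\infty}\sup\{|\chi(s,i,t,j)|:(s,i,t,j)\in\mathrm{dom}\,\chi,\ 0\le t+j-(s+i)\le\tau\}=0$. A complete, bounded hybrid arc $\psi$ is a vanishing inflation solution of the hybrid inclusion if there exists $\chi\in\mathcal P(\psi)$ and, for each $\varepsilon>0$ and $T>0$, there exists $\kappa>0$ such that, for each $(s,i)\in\mathrm{dom}\,\psi$ with $s+i\ge\kappa$, the mapping $\psi_{\chi,T}^{(s,i)}$ with domain $\mathrm{dom}\,\psi^{(s,i)}\cap\{(t,j)\in\mathbb R_{\ge0}\times\mathbb Z_{\ge0}:t+j\le T\}$ and values $\psi_{\chi,T}^{(s,i)}(t,j)=\psi^{(s,i)}(t,j)+\chi(s,i,s+t,i+j)$ is a solution of the $\varepsilon$-inflated system. *)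

(* Defs.v *)
From HB Require Import structures.
From mathcomp Require Import all_boot all_order all_algebra.
From mathcomp Require Import all_classical all_reals all_analysis.

Set Implicit Arguments.
Unset Strict Implicit.
Unset Printing Implicit Defensive.

Import Order.TTheory GRing.Theory Num.Theory.
Import numFieldNormedType.Exports.

Local Open Scope classical_set_scope.
Local Open Scope ring_scope.

(* The library norm on ['rV[R]_n] is the sup norm. It induces the usual
   topology and the usual bounded sets, so it is used for those; wherever a
   radius or a length is quantified, the Euclidean norm below is used. *)
Definition enorm (R : realType) (n : nat) (x : 'rV[R]_n) : R :=
  Num.sqrt (\sum_(i < n) x ord0 i ^+ 2).

Definition eball (R : realType) (n : nat) (r : R) : set 'rV[R]_n :=
  [set x | enorm x <= r].
Arguments eball {R} n r.

Definition minkowski_add (R : realType) (n : nat) (A B : set 'rV[R]_n) :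
    set 'rV[R]_n :=
  [set a + b | a in A & b in B].

Definition closed_convex_hull (R : realType) (n : nat) (A : set 'rV[R]_n) :
    set 'rV[R]_n :=
  closure (smallest (@convex_set R 'rV[R]_n) A).

Definition absolutely_continuous_on (R : realType) (n : nat)
    (f : R -> 'rV[R]_n) (a b : R) : Prop :=
  forall eps : R, 0 < eps -> exists2 delta : R, 0 < delta &
    forall (m : nat) (u v : 'I_m -> R),
      (forall i, a <= u i /\ u i <= v i /\ v i <= b) ->
      trivIset setT (fun i => [set` `]u i, v i[]) ->
      \sum_(i < m) (v i - u i) < delta ->
      \sum_(i < m) enorm (f (v i) - f (u i)) < eps.

Definition outer_semicontinuous (T U : topologicalType) (F : T -> set U) :=
  forall (x : nat -> T) (y : nat -> U) (x0 : T) (y0 : U),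
    x @ \oo --> x0 -> y @ \oo --> y0 ->
    (forall k, F (x k) (y k)) -> F x0 y0.

Definition locally_bounded (R : realType) (n : nat)
    (F : 'rV[R]_n -> set 'rV[R]_n) :=
  forall x : 'rV[R]_n, exists2 U : set 'rV[R]_n,
    nbhs x U & bounded_set (\bigcup_(y in U) F y).

Definition inner_limit (T : topologicalType) (S : nat -> set T) : set T :=
  [set z | exists2 x : nat -> T,
    (\forall k \near \oo, S k (x k)) & x @ \oo --> z].

Definition outer_limit (T : topologicalType) (S : nat -> set T) : set T :=
  [set z | exists (e : nat -> nat) (x : nat -> T),
    [/\ {homo e : k l / (k < l)%N}, forall k, S (e k) (x k)
      & x @ \oo --> z]].

Definition set_cvg (T : topologicalType) (S : nat -> set T) (L : set T) :=
  inner_limit S = L /\ outer_limit S = L.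

Definition gph (T U : Type) (M : T -> set U) : set (T * U) :=
  [set z | M z.1 z.2].

Definition graphical_cvg (T U : topologicalType) (M : nat -> T -> set U)
    (L : T -> set U) :=
  set_cvg (fun k => gph (M k)) (gph L).

Definition compact_hybrid_time_domain (R : realType) (E : set (R * nat)) :=
  exists (J : nat) (t : nat -> R),
    [/\ (1 <= J)%N, t 0%N = 0, forall i, (i < J)%N -> t i <= t i.+1
      & E = \bigcup_(i in [set i | (i < J)%N])
              ([set` `[t i, t i.+1]] `*` [set i])].

Definition hybrid_time_domain (R : realType) (E : set (R * nat)) :=
  exists K : nat -> set (R * nat),
    [/\ forall k, compact_hybrid_time_domain (K k),
        forall k, K k `<=` K k.+1
      & E = \bigcup_k K k].

(* A partial function from hybrid time to R^n. The values of [hval] outside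
   [hdom] are meaningless and never matter: see [set_valued] for the
   corresponding set-valued mapping. *)
Record hybrid_map (R : realType) (n : nat) := HybridMap {
  hdom : set (R * nat);
  hval : R -> nat -> 'rV[R]_n }.

Definition hybrid_curve (R : realType) (n : nat) (phi : hybrid_map R n) :=
  hybrid_time_domain (hdom phi) /\
  forall (j : nat) (t t' : R), hdom phi (t, j) -> hdom phi (t', j) -> t < t' ->
    {within `[t, t'], continuous (fun r => hval phi r j)}.

Definition hybrid_arc (R : realType) (n : nat) (phi : hybrid_map R n) :=
  hybrid_curve phi /\
  forall (j : nat) (t t' : R), hdom phi (t, j) -> hdom phi (t', j) -> t < t' ->
    absolutely_continuous_on (fun r => hval phi r j) t t'.

Definition complete_map (R : realType) (n : nat) (phi : hybrid_map R n) :=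
  forall M : R, exists2 p, hdom phi p & M < p.1 + p.2%:R.

Definition bounded_map (R : realType) (n : nat) (phi : hybrid_map R n) :=
  [bounded hval phi p.1 p.2 | p in hdom phi].

Definition tail (R : realType) (n : nat) (phi : hybrid_map R n)
    (s : R) (i : nat) : hybrid_map R n :=
  HybridMap [set p | 0 <= p.1 /\ hdom phi (s + p.1, (i + p.2)%N)]
            (fun t j => hval phi (s + t) (i + j)).

Definition set_valued (R : realType) (n : nat) (phi : hybrid_map R n) :
    R * R -> set 'rV[R]_n :=
  fun p => [set x | exists j : nat,
    [/\ p.2 = j%:R, hdom phi (p.1, j) & x = hval phi p.1 j]].

Record hybrid_data (R : realType) (n : nat) := HybridData {
  flow_set : set 'rV[R]_n;
  flow_map : 'rV[R]_n -> set 'rV[R]_n;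
  jump_set : set 'rV[R]_n;
  jump_map : 'rV[R]_n -> set 'rV[R]_n }.

Definition hybrid_basic_conditions (R : realType) (n : nat)
    (H : hybrid_data R n) : Prop :=
  [/\ closed (flow_set H) /\ closed (jump_set H),
      outer_semicontinuous (flow_map H) /\ locally_bounded (flow_map H),
      outer_semicontinuous (jump_map H) /\ locally_bounded (jump_map H),
      forall x, flow_set H x ->
        flow_map H x !=set0 /\ @convex_set R 'rV[R]_n (flow_map H x)
    & forall x, jump_set H x -> jump_map H x !=set0].

(* The two-sided derivative at [r] only depends on the values of the map on
   its domain when [r] is interior to [[t, t']]; the endpoints are negligible. *)
Definition solution (R : realType) (n : nat) (H : hybrid_data R n)
    (phi : hybrid_map R n) : Prop :=
  [/\ hybrid_arc phi,
      (flow_set H `|` jump_set H) (hval phi 0 0),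
      forall (j : nat) (t t' : R), t < t' ->
        (`[t, t'] `*` [set j]) `<=` hdom phi ->
        {ae lebesgue_measure, forall r : R, r \in `[t, t'] ->
          [/\ flow_set H (hval phi r j),
              derivable (fun u => hval phi u j) r 1
            & flow_map H (hval phi r j) (derive1 (fun u => hval phi u j) r)]}
    & forall (j : nat) (t : R), hdom phi (t, j) -> hdom phi (t, j.+1) ->
        jump_set H (hval phi t j) /\
        jump_map H (hval phi t j) (hval phi t j.+1)].

Definition asymptotic_solution (R : realType) (n : nat) (H : hybrid_data R n)
    (phi : hybrid_map R n) : Prop :=
  [/\ hybrid_curve phi, bounded_map phi, complete_map phi
    & forall (t : nat -> R) (j : nat -> nat) (L : R * R -> set 'rV[R]_n),
        (forall k, hdom phi (t k, j k)) ->
        (fun k => t k + (j k)%:R) @ \oo --> +oo ->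
        graphical_cvg (fun k => set_valued (tail phi (t k) (j k))) L ->
        exists psi : hybrid_map R n,
          [/\ solution H psi, complete_map psi & L = set_valued psi]].

Definition inflation (R : realType) (n : nat) (H : hybrid_data R n) (eps : R) :
    hybrid_data R n :=
  let nbh x := minkowski_add [set x] (eball n eps) in
  HybridData
    (minkowski_add (flow_set H) (eball n eps))
    (fun x => minkowski_add
       (closed_convex_hull
          (\bigcup_(y in nbh x `&` flow_set H) flow_map H y))
       (eball n eps))
    (minkowski_add (jump_set H) (eball n eps))
    (fun x => minkowski_add
       (\bigcup_(y in nbh x `&` jump_set H) jump_map H y)
       (eball n eps)).

Definition perturbation_dom (R : realType) (n : nat) (psi : hybrid_map R n) :
    set ((R * nat) * (R * nat)) :=
  [set w | [/\ hdom psi w.1, hdom psi w.2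
             & w.1.1 + w.1.2%:R <= w.2.1 + w.2.2%:R]].

(* [s + i -> +oo] with [(s, i)] restricted to the domain of [psi]: off it the
   supremum in [vanishing_perturbation] is that of the empty set. *)
Definition hybrid_time_infty (R : realType) (n : nat) (psi : hybrid_map R n) :
    set_system (R * nat) :=
  filter_from [set: R] (fun M => [set p | hdom psi p /\ M < p.1 + p.2%:R]).

(* The partial function with domain [perturbation_dom psi] is represented by a
   function of (s, i, t, j) that is only constrained, and only used, there. *)
Definition vanishing_perturbation (R : realType) (n : nat)
    (psi : hybrid_map R n) (chi : R -> nat -> R -> nat -> 'rV[R]_n) : Prop :=
  (forall (s : R) (i : nat) (t1 t2 : R) (j : nat),
     perturbation_dom psi ((s, i), (t1, j)) ->
     perturbation_dom psi ((s, i), (t2, j)) -> t1 < t2 ->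
     absolutely_continuous_on (fun t => chi s i t j) t1 t2) /\
  (forall tau : R, 0 < tau ->
     (fun p => ereal_sup [set (enorm (chi p.1 p.2 q.1 q.2))%:E |
        q in [set q | perturbation_dom psi (p, q) /\
                0 <= q.1 + q.2%:R - (p.1 + p.2%:R) <= tau]])
       @ hybrid_time_infty psi --> 0%E).

Definition perturbed_tail (R : realType) (n : nat) (psi : hybrid_map R n)
    (chi : R -> nat -> R -> nat -> 'rV[R]_n) (T s : R) (i : nat) :
    hybrid_map R n :=
  HybridMap
    (hdom (tail psi s i) `&` [set p | 0 <= p.1 /\ p.1 + p.2%:R <= T])
    (fun t j => hval (tail psi s i) t j + chi s i (s + t) (i + j)%N).

Definition vanishing_inflation_solution (R : realType) (n : nat)
    (H : hybrid_data R n) (psi : hybrid_map R n) : Prop :=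
  [/\ hybrid_arc psi, complete_map psi, bounded_map psi
    & exists2 chi, vanishing_perturbation psi chi &
        forall eps T : R, 0 < eps -> 0 < T ->
          exists2 kappa : R, 0 < kappa &
            forall (s : R) (i : nat), hdom psi (s, i) -> kappa <= s + i%:R ->
              solution (inflation H eps) (perturbed_tail psi chi T s i)].

(* Main.v *)
Require Import Defs.
From HB Require Import structures.
From mathcomp Require Import all_boot all_order all_algebra.
From mathcomp Require Import all_classical all_reals all_analysis.
From mathcomp Require Import ring lra.

(** The perturbed tails of [psi] solve inflated systems whose inflation radius
    tends to zero, and they differ from the tails by a quantity that vanishes
    uniformly on bounded horizons. So a graphical limit of tails is also a
    limit of these perturbed solutions, and it remains to see that solutions of
    inflated systems converge to solutions of the original one.

    All estimates are made in the sup norm, which is dominated by the Euclidean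
    norm, so that radii of inflation remain valid bounds.

    Equicontinuity. All values stay in a bounded set, on which the inflated flow
    maps are uniformly bounded; hence the perturbed tails share one Lipschitz
    constant along flows ([inflated_solution_lipschitz]). Consequently the limit
    takes a single value at each hybrid time and inherits that constant
    ([limit_lipschitz]). A hybrid time domain is described by order conditions
    on its points ([staircase]), which survive the limit
    ([limit_dom_staircase]), and compactness of bounded sets of hybrid
    times makes the limit domain unbounded ([limit_dom_unbounded]).

    Jumps and the initial condition only involve finitely many points, so they
    pass to the limit by closedness of [C], [D] and outer semicontinuity of [G].

    Flows. The derivatives of the approximating curves need not converge, but
    their difference quotients do. By the mean value inclusion
    ([ac_mean_value]), the difference quotient of a perturbed solution over a
    short interval near time [r] belongs to the closure of any convex set
    containing the velocities; here that set is a small neighbourhood of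
    [F (xi r)], which is convex and, by outer semicontinuity and local
    boundedness, contains every velocity available to the inflated system near
    [xi r] ([inflation_flow_map_near]). Letting the inflation vanish and then
    shrinking the interval puts the derivative of the limit in [F (xi r)]
    wherever it exists ([limit_flow_map]), and a Lipschitz curve has a derivative
    almost everywhere ([lipschitz_ae_derivable]). *)

Set Implicit Arguments.
Unset Strict Implicit.
Unset Printing Implicit Defensive.

Import Order.TTheory GRing.Theory Num.Theory.
Import numFieldNormedType.Exports.

Local Open Scope classical_set_scope.
Local Open Scope ring_scope.

(** * Differentiability almost everywhere of Lipschitz functions *)

Section lipschitz_differentiability.
Context {R : realType}.
Notation mu := (@lebesgue_measure R).

(** The Stieltjes measure of [G] and that of [x - G x] add up to Lebesgue
    measure, so the former is dominated by the latter; [G] is then a primitive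
    of its Radon-Nikodym density, and Lebesgue differentiation applies. *)
Lemma slow_ae_derivable (G : R -> R) (a b : R) : a < b ->
  (forall x y, x <= y -> 0 <= G y - G x <= y - x) ->
  {ae mu, forall x, a < x < b -> derivable G x 1}.
Proof.
move=> ab slowG.
have lip_rc (g : R -> R) : (forall x y, x <= y -> 0 <= g y - g x <= y - x) ->
    right_continuous g.
  move=> slow x; apply/cvgrPdist_le => e e0.
  near=> y.
  have xy : x <= y by near: y; apply: nbhs_right_ge.
  rewrite distrC ger0_norm; last by have /andP[] := slow _ _ xy.
  have /andP[_ /le_trans] := slow _ _ xy; apply.
  by rewrite lerBlDl; near: y; apply: nbhs_right_le; rewrite ltrDl.
have lip_nd (g : R -> R) : (forall x y, x <= y -> 0 <= g y - g x <= y - x) ->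
    {homo g : x y / x <= y}.
  by move=> slow x y xy; rewrite -subr_ge0; have /andP[] := slow _ _ xy.
pose G' := fun x => x - G x.
have slowG' x y : x <= y -> 0 <= G' y - G' x <= y - x.
  by move=> xy; have /andP[] := slowG _ _ xy; rewrite /G'; lra.
pose cG : cumulative R R := HB.pack G
  (isCumulative.Build R _ R G (lip_nd _ slowG) (lip_rc _ slowG)).
pose cG' : cumulative R R := HB.pack G'
  (isCumulative.Build R _ R G' (lip_nd _ slowG') (lip_rc _ slowG')).
pose nu : {measure set (measurableTypeR R) -> \bar R} := lebesgue_stieltjes_measure cG.
pose nu' : {measure set (measurableTypeR R) -> \bar R} := lebesgue_stieltjes_measure cG'.
have nuE x y : x <= y -> nu `]x, y]%classic = (G y - G x)%:E.
  move=> xy; rewrite /= /lebesgue_stieltjes_measure /measure_extension.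
  rewrite measurable_mu_extE/=.
    by rewrite wlength_itv_bnd.
  exact: is_ocitv.
have nuE' x y : x <= y -> nu' `]x, y]%classic = (G' y - G' x)%:E.
  move=> xy; rewrite /= /lebesgue_stieltjes_measure /measure_extension.
  rewrite measurable_mu_extE/=.
    by rewrite wlength_itv_bnd.
  exact: is_ocitv.
have sumE A : measurable A -> mu A = (nu A + nu' A)%E.
  move=> mA; rewrite -(measure_addE nu nu').
  apply: lebesgue_measure_unique => //.
  move=> X /ocitvP[->|[[x y]/= xy ->]]; first by rewrite !measure0.
  rewrite [RHS]measure_addE nuE ?nuE' ?(ltW xy)//.
  rewrite lebesgue_measure_itv/= lte_fin xy -EFinD/G'; congr EFin; ring.
have mab : measurable (`]a, b]%classic : set (measurableTypeR R)).
  exact: measurable_itv.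
have fin_ab : (nu `]a, b]%classic < +oo)%E by rewrite nuE ?ltW// ltry.
pose nuf := mfrestr mab fin_ab.
(* the density is only available for finite measures, hence the restriction *)
have dom : nuf `<< mu.
  apply/null_content_dominatesP => A mA A0.
  apply/eqP; rewrite eq_le measure_ge0 andbT.
  apply: (@le_trans _ _ (nu A)); last first.
    by rewrite -[leRHS]A0 [leRHS]sumE// leeDl.
  rewrite /nuf /mfrestr /mrestr.
  by apply: (le_measure nu); rewrite ?inE//; exact: measurableI.
have [f [_ ffin fint fE]] := radon_nikodym_sigma_finite dom.
pose h := fine \o f.
have hE : EFin \o h = f by apply/funext => x /=; rewrite fineK.
have hint : mu.-integrable setT (EFin \o h) by rewrite hE.
have hloc : locally_integrable setT h.
  by apply: open_integrable_locally => //; exact: openT.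
have hI y : mu.-integrable [set` Interval (BRight a) (BRight y)] (EFin \o h).
  by apply: integrableS hint.
have /= := FTC1 hI hloc.
apply: filterS; first exact: (ae_filter_ringOfSetsType mu).
move=> x dx /andP[ax xb].
have {dx} [dx _] := dx ax.
have FE y : a < y < b -> 
    \int[mu]_(t in [set` Interval (BRight a) (BRight y)]) h t = G y - G a.
  move=> /andP[ay yb]; rewrite /Rintegral.
  rewrite -[X in fine X](_ : nuf `]a, y]%classic = _); last first.
    by rewrite [LHS]fE// -hE.
  rewrite /nuf /mfrestr /mrestr setIidl; last first.
    by move=> z /=; rewrite !in_itv/= => /andP[-> /le_trans ->//]; rewrite ltW.
  by rewrite nuE ?ltW.
have := derivableD dx (@derivable_cst R R R (G a) x 1).
apply: near_eq_derivable.
near=> y; rewrite [LHS]/GRing.add/= FE ?subrK//; apply/andP; split; near: y.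
  exact: lt_nbhsr.
exact: lt_nbhsl.
Unshelve. all: by end_near. Qed.

(** After a rescaling by a constant [L] larger than the Lipschitz constant,
    [(x + g x / L) / 2] and its difference with [x] are both nondecreasing. *)
Lemma lipschitz_ae_derivable (g : R -> R) (l a b : R) :
  (forall x y, a <= x <= b -> a <= y <= b -> `|g x - g y| <= l * `|x - y|) ->
  {ae mu, forall x, a < x < b -> derivable g x 1}.
Proof.
move=> lip; have [ab|ba] := ltP a b; last first.
  apply: aeW => x /andP[ax xb].
  by have := lt_trans ax xb; rewrite ltNge ba.
pose L := `|l| + 1.
have L0 : 0 < L by rewrite ltr_wpDl.
(* [g] is extended to the real line by constants *)
pose p x := Num.max a (Num.min b x).
have pab x : a <= p x <= b.
  by rewrite /p le_max lexx/= ge_max (ltW ab)/= ge_min lexx.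
have p_id x : a < x < b -> p x = x.
  by move=> /andP[ax xb]; rewrite /p min_r ?max_r// ltW.
have p_lip x y : x <= y -> 0 <= p y - p x <= y - x.
  move=> xy; rewrite /p.
  have [|] := leP b x; have [|] := leP b y => ? ?; rewrite ?(max_r (ltW ab));
  have [|] := leP a x; have [|] := leP a y => ? ?; lra.
pose G x := (x + g (p x) / L) / 2.
have /slow_ae_derivable : forall x y, x <= y -> 0 <= G y - G x <= y - x.
  move=> x y xy.
  have /lip/(_ (pab x)) := pab y.
  have /andP[pp0 pp1] := p_lip _ _ xy.
  rewrite (ger0_norm pp0) => gp.
  have : `|(g (p y) - g (p x)) / L| <= y - x.
    rewrite normrM (gtr0_norm (_ : 0 < L^-1)) ?invr_gt0// ler_pdivrMr//.
    have lL : l <= L by rewrite (le_trans (ler_norm _))// /L lerDl.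
    apply: (le_trans gp); apply: le_trans (ler_wpM2r pp0 lL) _.
    by rewrite mulrC ler_wpM2r// ltW.
  rewrite ler_norml /G; lra.
move/(_ _ _ ab); apply: filterS; first exact: (ae_filter_ringOfSetsType mu).
move=> x + /[dup] axb /andP[ax xb] => /(_ axb) dG.
have := derivableZ (k := L) (derivableB (derivableZ (k := 2) dG) (@derivable_id R R x 1)).
apply: near_eq_derivable; near=> y.
have ayb : a < y < b.
  apply/andP; split; near: y.
    exact: lt_nbhsr.
  exact: lt_nbhsl.
transitivity (L * (2 * G y - y)) => //; rewrite /G p_id//.
by field; rewrite gt_eqF.
Unshelve. all: by end_near. Qed.

End lipschitz_differentiability.

(** * Tools for the mean value inclusion *)

Section mean_value.
Context {R : realType}.
Notation mu := (@lebesgue_measure R).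

(** Induction along a segment: the supremum of the points reachable from [a]
    is itself reachable, by the local property, and cannot be less than [b].
    This replaces the choice of a fine tagged partition. *)
Lemma local_to_global (P : R -> R -> Prop) (a b : R) : a <= b ->
  (forall u v w, a <= u -> u <= v -> v <= w -> w <= b ->
     P u v -> P v w -> P u w) ->
  (forall c, a <= c <= b -> exists2 d, 0 < d &
     forall u v, a <= u -> u <= c -> c <= v -> v <= b ->
       c - d < u -> v < c + d -> P u v) ->
  P a b.
Proof.
move=> ab Padd Ploc.
pose S := [set x | a <= x <= b /\ P a x].
have Sa : S a.
  split; first by rewrite lexx.
  have [|d d0] := Ploc a; first by rewrite lexx.
  by apply => //; rewrite ?ltrBlDr ltrDl.
have Sb : ubound S b by move=> x [/andP[]].
have supS : has_sup S by split; [exists a|exists b].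
have as_ : a <= sup S by apply: ub_le_sup => //; exists b.
have sb : sup S <= b by apply: ge_sup => //; exists a.
have [|d d0 Pd] := Ploc (sup S); first by rewrite as_.
have [x [/andP[ax xb] Pax] dx] := sup_adherent d0 supS.
have xs : x <= sup S by apply: ub_le_sup; [exists b|split=> //; rewrite ax].
have Pas : P a (sup S).
  by apply: (Padd _ x) => //; apply: Pd => //; rewrite ltrDl.
pose y := Num.min b (sup S + d / 2).
have yb : y <= b by rewrite /y ge_min lexx.
have sy : sup S <= y by rewrite /y le_min sb lerDl divr_ge0// ltW.
have Pay : P a y.
  apply: (Padd _ (sup S)) => //; apply: Pd => //; first by rewrite gtrBl.
  by rewrite /y gt_min ltrD2l ltr_pdivrMr// mulr2n mulrDr mulr1 ltrDl d0 orbT.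
have ys : y <= sup S.
  by apply: ub_le_sup; [exists b|split=> //; rewrite (le_trans as_)].
have <- // : y = b.
apply/eqP; rewrite eq_le yb/= leNgt; apply/negP => yltb.
move: ys; rewrite leNgt => /negP; apply.
by rewrite /y lt_min (le_lt_trans sy yltb) ltrDl divr_gt0.
Qed.

Lemma ae_exists (P : R -> Prop) (a b : R) : a < b ->
  {ae mu, forall r, r \in `[a, b] -> P r} -> exists2 r, a <= r <= b & P r.
Proof.
move=> ab [N [mN N0 PN]]; apply: contrapT => nP.
have : (mu `[a, b]%classic <= mu N)%E.
  rewrite le_measure ?inE// => r rab; apply: PN => /= Pr.
  by apply: nP; exists r; [move: rab; rewrite /= in_itv|exact: Pr].
rewrite N0 lebesgue_measure_itv/= lte_fin ab -EFinB lee_fin.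
by rewrite subr_le0 leNgt ab.
Qed.

Lemma convex_comb n (K : set 'rV[R]_n) (x y : R) u v :
  @convex_set R 'rV[R]_n K -> 0 <= x -> 0 <= y -> K u -> K v ->
  exists2 w, K w & x *: u + y *: v = (x + y) *: w.
Proof.
move=> cK x0 y0 Ku Kv.
have [xy0|xy] := eqVneq (x + y) 0.
  have [-> ->] : x = 0 /\ y = 0 by split; lra.
  by exists u; rewrite ?addr0 ?scale0r ?addr0.
have p0 : 0 <= x / (x + y) by rewrite divr_ge0// addr_ge0.
have p1 : x / (x + y) <= 1.
  by rewrite ler_pdivrMr ?mul1r ?lerDl// lt_neqAle eq_sym xy addr_ge0.
have := cK u v (Itv01 p0 p1); rewrite !inE => /(_ Ku Kv) Kw.
eexists; first exact: Kw.
rewrite [X in _ = _ *: X](_ : _ =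
  (x / (x + y)) *: u + (1 - x / (x + y)) *: v)//.
by rewrite scalerDr !scalerA; congr (_ *: _ + _ *: _); field.
Qed.

End mean_value.

Section euclidean_norm.
Context {R : realType} {n : nat}.
Implicit Types x : 'rV[R]_n.

Lemma norm_row_le x (r : R) : 0 <= r ->
  (forall i, `|x ord0 i| <= r) -> `|x| <= r.
Proof.
move=> r0 xr; rewrite [leLHS]/Num.Def.normr/= mx_normrE.
by apply: bigmax_le => // -[i j] _ /=; rewrite ord1.
Qed.

Lemma entry_le_norm x i : `|x ord0 i| <= `|x|.
Proof.
rewrite [leRHS]/Num.Def.normr/= mx_normrE.
exact: (le_bigmax (0 : R) (fun ij : 'I_1 * 'I_n => `|x ij.1 ij.2|) (ord0, i)).
Qed.

Lemma norm_le_enorm x : `|x| <= enorm x.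
Proof.
apply: norm_row_le => [|i]; first exact: sqrtr_ge0.
rewrite -sqrtr_sqr ler_wsqrtr// (bigD1 i)//= lerDl.
by apply: sumr_ge0 => j _; exact: sqr_ge0.
Qed.

Lemma enorm_le_norm x : enorm x <= n%:R * `|x|.
Proof.
rewrite -[leRHS]ger0_norm ?mulr_ge0// -sqrtr_sqr ler_wsqrtr//.
have [n0|n0] := posnP n.
  by rewrite big1 ?sqr_ge0// => -[m mn] _; exfalso; move: mn; rewrite n0.
apply: (@le_trans _ _ (\sum_(i < n) `|x| ^+ 2)).
  apply: ler_sum => i _; rewrite -(ger0_norm (sqr_ge0 (x ord0 i))) normrX.
  by rewrite lerXn2r ?nnegrE// entry_le_norm.
rewrite sumr_const card_ord exprMn -[leLHS]mulr_natl ler_wpM2r ?sqr_ge0//.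
by rewrite -natrX ler_nat expnS expn1 leq_pmull.
Qed.

End euclidean_norm.

Section absolute_continuity.
Context {R : realType} {n : nat}.
Notation mu := (@lebesgue_measure R).
Notation before := (fun x y : R * R => x.2 <= y.1).

(** Peeling off the leftmost interval leaves the others in the half-line to
    its right, so the bound follows by additivity on two disjoint pieces. *)
Lemma ordered_intervals_length (s : seq (R * R)) (U : set R) :
  measurable U -> pairwise before s ->
  (forall x, x \in s -> x.1 <= x.2 /\ [set` `]x.1, x.2[] `<=` U) ->
  ((\sum_(x <- s) (x.2 - x.1))%:E <= mu U)%E.
Proof.
elim: s U => [|x s IH] U mU /=; first by rewrite big_nil measure_ge0.
move=> /andP[xs ss] sU.
have [x12 xU] := sU x (mem_head _ _).
rewrite big_cons EFinD.
have mI : measurable (U `&` `[x.2, +oo[ : set R) by exact: measurableI.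
have dis : `]x.1, x.2[ `&` (U `&` `[x.2, +oo[) = set0.
  apply/seteqP; split => // z [/=]; rewrite !in_itv/= andbT => /andP[_ zx] [_].
  by rewrite leNgt zx.
apply: (@le_trans _ _ (mu (`]x.1, x.2[ `|` (U `&` `[x.2, +oo[)))); last first.
  rewrite le_measure ?inE//; first exact: measurableU.
  by move=> z [/xU//|[]].
rewrite [leRHS]measureU//; apply: leeD.
  rewrite [leRHS](@lebesgue_measure_itv R)/= lte_fin; case: ltP => //.
  by rewrite lee_fin subr_le0.
apply: IH => // y ys; have := sU y; rewrite inE ys orbT => /(_ isT)[y12 yU].
split=> // z /[dup] /yU Uz; rewrite /= !in_itv/= andbT => /andP[yz _]; split=> //.
by rewrite (le_trans _ (ltW yz))//; exact: (allP xs).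
Qed.

(** Lists of consecutive intervals can be concatenated, which families indexed
    by ordinals do not do conveniently; hence this form of the definition. *)
Lemma absolutely_continuous_on_seq (f : R -> 'rV[R]_n) a b :
  absolutely_continuous_on f a b -> forall e, 0 < e -> exists2 d, 0 < d &
  forall s : seq (R * R), pairwise before s ->
    (forall x, x \in s -> [/\ a <= x.1, x.1 <= x.2 & x.2 <= b]) ->
    \sum_(x <- s) (x.2 - x.1) < d ->
    \sum_(x <- s) `|f x.2 - f x.1| < e.
Proof.
move=> ac e e0; have [d d0 acd] := ac e e0; exists d => // s ss sab sd.
pose u (i : 'I_(size s)) := (nth (0, 0) s i).1.
pose v (i : 'I_(size s)) := (nth (0, 0) s i).2.
have uvab i : [/\ a <= u i, u i <= v i & v i <= b].
  by apply: sab; exact: mem_nth.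
have vu (i j : 'I_(size s)) : (i < j)%N -> v i <= u j.
  by move=> ij; have /(pairwiseP (0, 0)) := ss; apply=> //; rewrite inE.
rewrite (big_nth (0, 0)) big_mkord.
apply: (@le_lt_trans _ _ (\sum_(i < size s) enorm (f (v i) - f (u i)))).
  by apply: ler_sum => i _; exact: norm_le_enorm.
apply: acd.
- by move=> i; have [] := uvab i.
- apply/trivIsetP => i j _ _; rewrite -val_eqE neq_ltn => ij.
  apply/seteqP; split => // z [/=]; rewrite !in_itv/= => /andP[uiz zvi] /andP[ujz zvj].
  by case/orP: ij => /vu ij; exfalso; lra.
- by move: sd; rewrite (big_nth (0, 0)) big_mkord.
Qed.

End absolute_continuity.

(** * The mean value inclusion for absolutely continuous curves *)

Section ac_mean_value.
Context {R : realType} {n : nat}.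
Notation mu := (@lebesgue_measure R).
Implicit Types f : R -> 'rV[R]_n.

Lemma derivable_expansion f (c : R) : derivable f c 1 ->
  forall e, 0 < e -> exists2 d, 0 < d & forall x, `|x - c| < d ->
    `|f x - f c - (x - c) *: f^`()%classic c| <= e * `|x - c|.
Proof.
move=> df e e0.
have : h^-1 *: ((f \o shift c) (h *: 1) - f c) @[h --> 0^'] --> f^`()%classic c.
  by rewrite derive1E.
move/cvgrPdist_le => /(_ e e0) [d /= d0 dP]; exists d => // x xd.
have [->|xc] := eqVneq x c; first by rewrite !subrr scale0r subr0 !normr0 mulr0.
have h0 : x - c != 0 by rewrite subr_eq0.
have := dP (x - c); rewrite /= sub0r normrN => /(_ xd h0).
rewrite /= /GRing.scale/= mulr1 subrK => H.
rewrite -[f x - f c](scalerKV h0) -scalerBr normrZ mulrC ler_wpM2r//.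
by rewrite distrC.
Qed.

(** The exceptional null set lies in an open [U] of small measure. Around a
    point of differentiability the increment of [f] is nearly a multiple of an
    element of [K]; around an exceptional point a whole interval lies in [U].
    Gluing such pieces gives the increment over [[a, b]] as a multiple of an
    element of [K], up to the increments over disjoint intervals in [U], and
    these are negligible by absolute continuity. *)
Lemma ac_mean_value f (a b : R) (K : set 'rV[R]_n) : a < b ->
  absolutely_continuous_on f a b -> @convex_set R 'rV[R]_n K ->
  {ae mu, forall r, r \in `[a, b] -> derivable f r 1 /\ K (f^`()%classic r)} ->
  closure K ((b - a)^-1 *: (f b - f a)).
Proof.
move=> ab ac cK aeK.
have [r0 _ [_ Kk0]] := ae_exists ab aeK; set k0 := f^`()%classic r0 in Kk0.
have [N [mN N0 PN]] := aeK.
have D0 : 0 < b - a by rewrite subr_gt0.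
set D := b - a in D0 *; pose B := `|f b - f a|.
(* the elements of [K] met below give the increment of [f], up to a small
   error, after multiplication by at least [D / 2]; this bounds them *)
pose M := 2 * (B + D * (D + 1)) / D.
have M0 : 0 <= M.
  have B0 : 0 <= B by exact: normr_ge0.
  by apply: divr_ge0; nra.
have DM0 : 0 < D + 1 + M by rewrite ltr_wpDr// addr_gt0.
suff approx e1 : 0 < e1 -> e1 <= D / 2 ->
    exists2 k, K k & `|D^-1 *: (f b - f a) - k| <= e1 * ((D + 1 + M) / D).
  move=> A /nbhs_ballP[e /= e0 eA].
  pose e1 := Num.min (D / 2) (e / 2 / ((D + 1 + M) / D)).
  have [||k Kk ke] := approx e1.
  - by rewrite lt_min !divr_gt0.
  - by rewrite ge_min lexx.
  - exists k; split=> //; apply: eA; rewrite -ball_normE/=.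
    apply: le_lt_trans ke _.
    apply: (@le_lt_trans _ _ (e / 2)); last by rewrite ltr_pdivrMr// ltr_pMr// ltr1n.
    by rewrite -ler_pdivlMr ?divr_gt0// /e1 ge_min lexx orbT.
move=> e10 e1D.
have [d d0 acd] := absolutely_continuous_on_seq ac e10.
have [U [oU NU muU]] : exists U : set R, [/\ open U, N `<=` U &
    (mu U < (Num.min d e1)%:E)%E].
  have [||U [oU NU muU]] := @lebesgue_regularity_outer R N (Num.min d e1) mN.
  - by rewrite [X in (X < _)%E](_ : _ = 0%E)// ltry.
  - by rewrite lt_min d0.
  - exists U; split => //; rewrite -(setDUK NU) measureU//.
    + by rewrite [X in (X + _)%E](_ : _ = 0%E)// add0e.
    + by apply: measurableD => //; exact: measurable_realfun.open_measurable.
    + by apply/seteqP; split => // z [Nz []].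
(* [s] lists the intervals charged to the exceptional set *)
pose P u v := exists (s : seq (R * R)) k,
  [/\ pairwise (fun x y : R * R => x.2 <= y.1) s,
      forall x, x \in s -> [/\ u <= x.1, x.1 <= x.2, x.2 <= v &
        [set` `]x.1, x.2[] `<=` U],
      K k, \sum_(x <- s) (x.2 - x.1) <= v - u &
      `|f v - f u - (v - u - \sum_(x <- s) (x.2 - x.1)) *: k -
        \sum_(x <- s) (f x.2 - f x.1)| <= e1 * (v - u)].
have : P a b.
  apply: local_to_global; first exact: ltW.
  - move=> u v w au uv vw wb [s1 [k1 [ ord1s s1U Kk1 L1 d1]]].
    move=> [s2 [k2 [ ord2s s2U Kk2 L2 d2]]].
    rewrite -subr_ge0 in L1; rewrite -subr_ge0 in L2.
    have [k Kk kE] := convex_comb cK L1 L2 Kk1 Kk2.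
    exists (s1 ++ s2), k; split => //.
    + rewrite pairwise_cat ord1s ord2s !andbT; apply/allrelP => x y xs1 ys2.
      have [_ _ xv _] := s1U x xs1; have [vy _ _ _] := s2U y ys2.
      exact: le_trans vy.
    + move=> x; rewrite mem_cat => /orP[/s1U|/s2U] [? ? ? ?]; split => //.
        by apply: le_trans vw.
      by apply: le_trans uv _.
    + by rewrite big_cat/=; lra.
    + rewrite !big_cat/=.
      rewrite [X in X *: k](_ : _ = (v - u - \sum_(x <- s1) (x.2 - x.1)) +
        (w - v - \sum_(x <- s2) (x.2 - x.1))); last by ring.
      rewrite -kE.
      have -> : e1 * (w - u) = e1 * (v - u) + e1 * (w - v) by ring.
      apply: le_trans (lerD d1 d2); apply: le_trans (ler_normD _ _).
      rewrite le_eqVlt; apply/orP; left; apply/eqP; congr `|_|.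
      set S1 := \sum_(_ <- s1) _; set S2 := \sum_(_ <- s2) _.
      set T1 := \sum_(_ <- s1) (_ - _); set T2 := \sum_(_ <- s2) (_ - _).
      by apply/rowP => i; rewrite !mxE; ring.
  - move=> c acb; have [Nc|Nc] := pselect (N c).
      have /NU/oU/nbhs_ballP[dc /= dc0 dcU] := Nc.
      exists dc => // u v au uc cv vb du dv.
      exists [:: (u, v)], k0; split => //=.
      + move=> x; rewrite inE => /eqP ->/=; split => //; first exact: le_trans cv.
        move=> z; rewrite /= in_itv/= => /andP[uz zv]; apply: dcU.
        by rewrite /ball/= ltr_norml; lra.
      + by rewrite big_seq1.
      + rewrite !big_seq1/= subrr scale0r subr0 subrr normr0.
        by rewrite mulr_ge0 ?(ltW e10)// subr_ge0 (le_trans uc).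
    have [dfc Kc] : derivable f c 1 /\ K (f^`()%classic c).
      apply: contrapT => nc; apply: Nc; apply: PN => /= H; apply: nc.
      by apply: H; rewrite in_itv.
    have [dc dc0 dcE] := derivable_expansion dfc e10.
    exists dc => // u v au uc cv vb du dv.
    exists [::], (f^`()%classic c); split => //.
    + by rewrite big_nil subr_ge0 (le_trans uc).
    + rewrite !big_nil subr0 subr0.
      have du' : `|u - c| < dc by rewrite ltr_norml; lra.
      have dv' : `|v - c| < dc by rewrite ltr_norml; lra.
      have := lerD (dcE v dv') (dcE u du').
      rewrite -mulrDr (ger0_norm (_ : 0 <= v - c)) ?subr_ge0//.
      rewrite (ler0_norm (_ : u - c <= 0)) ?subr_le0// opprB addrA subrK.
      apply: le_trans; apply: le_trans (ler_normB _ _).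
      rewrite le_eqVlt; apply/orP; left; apply/eqP; congr `|_|.
      by apply/rowP => i; rewrite !mxE; ring.
move=> [s [k [ ords sU Kk L dist]]].
have sd : (\sum_(x <- s) (x.2 - x.1)) < Num.min d e1.
  rewrite -lte_fin; apply: le_lt_trans muU; apply: ordered_intervals_length => //.
    exact: measurable_realfun.open_measurable.
  by move=> x /sU[].
move: sd; rewrite lt_min => /andP[sd se].
have bad : `|\sum_(x <- s) (f x.2 - f x.1)| <= e1.
  apply: le_trans (ler_norm_sum _ _ _) _; apply/ltW/acd => //.
  by move=> x /sU[].
have s0 : 0 <= \sum_(x <- s) (x.2 - x.1).
  by rewrite big_seq sumr_ge0// => x /sU[_ ? _ _]; rewrite subr_ge0.
exists k => //.
set S := \sum_(x <- s) (x.2 - x.1) in s0 se L dist sd.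
set T := \sum_(x <- s) (f x.2 - f x.1) in dist bad.
rewrite -/D in dist L.
have main : `|f b - f a - (D - S) *: k| <= e1 * (D + 1).
  rewrite -(subrK T (f b - f a - (D - S) *: k)).
  apply: le_trans (ler_normD _ _) _.
  by rewrite mulrDr mulr1 lerD.
have kM : `|k| <= M.
  have : (D - S) * `|k| <= B + e1 * (D + 1).
    rewrite -(ger0_norm (_ : 0 <= D - S)) ?subr_ge0// -normrZ.
    rewrite -(subKr (f b - f a) ((D - S) *: k)).
    by apply: le_trans (ler_normB _ _) _; rewrite lerD.
  rewrite /M ler_pdivlMr//.
  have := normr_ge0 k; have : 0 <= D by exact: ltW.
  nra.
have -> : D^-1 *: (f b - f a) - k =
    D^-1 *: (f b - f a - (D - S) *: k - S *: k).
  by rewrite -addrA -opprD -scalerDl subrK [RHS]scalerBr scalerK ?gt_eqF.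
rewrite normrZ gtr0_norm ?invr_gt0// mulrA [leRHS]mulrC.
apply: ler_wpM2l; first by rewrite invr_ge0 ltW.
apply: le_trans (ler_normB _ _) _.
rewrite mulrDr; apply: lerD => //.
by rewrite normrZ ger0_norm// ler_pM// ltW.
Qed.

End ac_mean_value.

(** * Subsequences of bounded sequences *)

Section subsequences.
Context {R : realType}.

Lemma increasing_cvg (e : nat -> nat) : {homo e : k l / (k < l)%N} ->
  e @ \oo --> \oo.
Proof.
move=> homo_e A [N _ NA]; exists N => // k /= Nk; apply: NA => /=.
apply: leq_trans Nk _; elim: k => // k IH.
by apply: leq_ltn_trans IH _; exact: homo_e.
Qed.

Lemma cvg_rowP n (x : nat -> 'rV[R]_n) (l : 'rV[R]_n) :
  (forall i, (fun k => x k ord0 i) @ \oo --> l ord0 i) -> x @ \oo --> l.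
Proof.
move=> xl; apply/cvgrPdist_le => e e0.
near=> k; apply: norm_row_le; first exact: ltW.
move=> i; rewrite !mxE; move: i; near: k; apply: filter_forall => i.
exact: ((cvgrPdist_le _ _).1 (xl i)).
Unshelve. all: by end_near. Qed.

Lemma bounded_family_subseq (u : nat -> nat -> R) (m : nat) :
  (forall i, exists M, forall k, `|u i k| <= M) ->
  exists2 e : nat -> nat, {homo e : k l / (k < l)%N} &
    forall i, (i < m)%N -> cvgn (u i \o e).
Proof.
move=> bu; elim: m => [|m [e he ue]]; first by exists id.
have [|f hf uf] := @bolzano_weierstrass R (u m \o e).
  have [M uM] := bu m; exists M; split; first exact: num_real.
  by move=> y My k _ /=; rewrite (le_trans (uM _))// ltW.
have {}hf := leW_mono hf.
have hf' : {homo f : k l / (k < l)%N}.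
  by move=> k l kl; have := hf k l; rewrite !ltEnat/= kl.
exists (e \o f) => [k l /hf'/he//|i]; rewrite ltnS leq_eqVlt => /orP[/eqP->//|im].
have /cvg_ex[l ul] := ue _ im; apply/cvg_ex; exists l.
exact: cvg_comp (increasing_cvg hf') ul.
Qed.

(** Times, indices and values are extracted together: the index becomes
    constant, and the time and the coordinates of the value form one finite
    family of bounded real sequences. *)
Lemma bounded_subseq n (t : nat -> R) (j : nat -> nat) (x : nat -> 'rV[R]_n)
    (M : R) (J : nat) :
  (forall k, `|t k| <= M) -> (forall k, (j k <= J)%N) ->
  (forall k, `|x k| <= M) ->
  exists (e : nat -> nat) (t0 : R) (j0 : nat) (x0 : 'rV[R]_n),
  [/\ {homo e : k l / (k < l)%N},
    forall k, j (e k) = j0, t \o e @ \oo --> t0 & x \o e @ \oo --> x0].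
Proof.
move=> tM jJ xM.
have [|j0 [A Ainf Aj]] := @finite_range_cst_subsequence _ j.
  apply: sub_finite_set (finite_II J.+1) => _ [k _ <-] /=.
  by rewrite ltnS.
have /= [|f [fincr _ Af]] := infinite_increasing_seq_wf _ Ainf 0.
  by move=> k; apply: sub_finite_set (finite_II k.+1) => l /=.
have hf : {homo f : k l / (k < l)%N}.
  by move=> k l kl; have := leW_mono fincr k l; rewrite !ltEnat/= kl.
(* index 0 is the time, index [i.+1] the coordinate [i] *)
pose u i k := if i is i'.+1 then
  (if insub i' is Some i'' then x (f k) ord0 (i'' : 'I_n) else 0) else t (f k).
have [|e he ue] := @bounded_family_subseq u n.+1.
  move=> i; exists M => k; rewrite /u; case: i => [//|i].
  case: insubP => [i' _ _|_]; first exact: le_trans (entry_le_norm _ _) _.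
  by rewrite normr0 (le_trans _ (tM 0)).
have /cvg_ex[/= t0 t0P] := ue 0 isT.
have xcvg (i : 'I_n) : cvgn (fun k => x (f (e k)) ord0 i).
  have := ue i.+1; rewrite ltnS => /(_ (ltn_ord i)).
  by rewrite /u/comp valK.
exists (f \o e), t0, j0, (\row_i limn (fun k => x (f (e k)) ord0 i)); split => //.
- by move=> k l /he/hf.
- by move=> k; apply/Aj; exact: Af.
- by apply: cvg_rowP => i; rewrite mxE; exact: xcvg.
Qed.

End subsequences.

(** * Outer semicontinuous maps and inflations *)

Section set_valued_maps.
Context {R : realType} {n : nat}.
Notation V := 'rV[R]_n.
Implicit Types (F : V -> set V) (K : set V).

Definition fattening K (r : R) : set V :=
  [set w | exists2 v, K v & `|w - v| <= r].

Lemma fatteningD K (r s : R) :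
  fattening (fattening K r) s `<=` fattening K (r + s).
Proof.
move=> w [v [u Ku vu] wv]; exists u => //.
by rewrite (le_trans (ler_distD v _ _))// addrC lerD.
Qed.

Lemma fatteningS K (r s : R) : r <= s -> fattening K r `<=` fattening K s.
Proof. by move=> rs w [v Kv wv]; exists v => //; exact: le_trans rs. Qed.

Lemma closure_fattening K (r : R) : 0 < r -> closure K `<=` fattening K r.
Proof.
move=> r0 w /(_ _ (nbhsx_ballx w r r0))[v [Kv]].
by rewrite -ball_normE/= => wv; exists v => //; exact: ltW.
Qed.

Lemma convex_fattening K (r : R) : @convex_set R V K ->
  @convex_set R V (fattening K r).
Proof.
move=> cK x y p; rewrite !inE => -[u Ku xu] [v Kv yv].
have := cK u v p; rewrite !inE => /(_ Ku Kv) Kuv.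
change (fattening K r (p%:num *: x + (1 - p%:num) *: y)).
exists (p%:num *: u + (1 - p%:num) *: v); first exact: Kuv.
have -> : p%:num *: x + (1 - p%:num) *: y - (p%:num *: u + (1 - p%:num) *: v) =
    p%:num *: (x - u) + (1 - p%:num) *: (y - v).
  by apply/rowP => i; rewrite !mxE; ring.
have p0 : 0 <= p%:num by [].
have p1 : 0 <= 1 - p%:num by rewrite subr_ge0.
rewrite (le_trans (ler_normD _ _))// !normrZ !ger0_norm//.
have := ler_wpM2l p0 xu; have := ler_wpM2l p1 yv; lra.
Qed.

Lemma norm_ball_convex (B : R) : @convex_set R 'rV[R]_n [set w | `|w| <= B].
Proof.
move=> x y p; rewrite !inE /= => xB yB.
change (`|p%:num *: x + (1 - p%:num) *: y : 'rV[R]_n| <= B).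
have p0 : 0 <= p%:num by [].
have p1 : 0 <= 1 - p%:num by rewrite subr_ge0.
rewrite (le_trans (ler_normD _ _))// !normrZ !ger0_norm//.
have := ler_wpM2l p0 xB; have := ler_wpM2l p1 yB; lra.
Qed.

Lemma invS_gt0 k : 0 < k.+1%:R^-1 :> R.
Proof. by rewrite invr_gt0. Qed.

Lemma near_cvg (x : nat -> V) l : (forall k, `|x k - l| <= k.+1%:R^-1) ->
  x @ \oo --> l.
Proof.
move=> xl; apply/cvgrPdist_le => e e0; near=> k.
rewrite distrC (le_trans (xl k))// ltW//; near: k.
exact: near_infty_natSinv_lt (PosNum e0).
Unshelve. all: by end_near. Qed.

(** For a fixed value of the map this says that [F x] is closed; with moving
    [x'] it allows limits to be taken without building sequences each time. *)
Lemma osc_approx_mem F (x y : V) : outer_semicontinuous F ->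
  (forall e, 0 < e -> exists x' y', [/\ `|x' - x| <= e, `|y' - y| <= e & F x' y']) ->
  F x y.
Proof.
move=> osc H.
have /choice[x' /choice[y' xy']] := fun k => H _ (invS_gt0 k).
by apply: (osc x' y') => [||k]; [apply: near_cvg => k..|]; have [] := xy' k.
Qed.

Lemma closed_approx_mem (A : set V) (x : V) : closed A ->
  (forall e, 0 < e -> exists2 y, A y & `|y - x| <= e) -> A x.
Proof.
move=> cA H; apply: cA => B /nbhs_ballP[e /= e0 eB].
have [|y Ay yx] := H (e / 2); first by rewrite divr_gt0.
exists y; split=> //; apply: eB; rewrite -ball_normE/= distrC.
by rewrite (le_lt_trans yx)// ltr_pdivrMr// ltr_pMr// ltr1n.
Qed.

(** Otherwise some points of the ball carry unbounded values; a limit point of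
    these has no neighbourhood on which [F] is bounded. *)
Lemma locally_bounded_on_balls F (M : R) : locally_bounded F ->
  exists B, forall x y, `|x| <= M -> F x y -> `|y| <= B.
Proof.
move=> lbF; apply: contrapT => nB.
have {}nB k : exists xy : V * V, [/\ `|xy.1| <= M, F xy.1 xy.2 & k%:R < `|xy.2|].
  apply: contrapT => nxy; apply: nB; exists k%:R => x y xM Fxy.
  by rewrite leNgt; apply/negP => ky; apply: nxy; exists (x, y).
have /choice[xy xyP] := nB.
have [|||e [_ [_ [x0 [he _ _ xe]]]]] :=
  @bounded_subseq R n (fun=> M) (fun=> 0) (fun k => (xy k).1) `|M| 0.
- by [].
- by [].
- by move=> k; have [/le_trans + _ _] := xyP k; apply; exact: ler_norm.
have [U Ux0 [B [_ BU]]] := lbF x0.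
have /xe[N _ NU] := Ux0.
near \oo => k.
have [_ Fk kk] := xyP (e k).
have : `|(xy (e k)).2| <= `|B| + 1.
  apply: BU; first by rewrite (le_lt_trans (ler_norm _))// ltrDl.
  by exists (xy (e k)).1 => //; apply: NU => /=; near: k; exact: nbhs_infty_ge.
apply/negP; rewrite -ltNge; apply: le_lt_trans kk.
apply: (@le_trans _ _ k%:R); first by near: k; exact: nbhs_infty_ger.
rewrite ler_nat; elim: {+}k => // m IH.
by apply: leq_ltn_trans IH _; exact: he.
Unshelve. all: by end_near. Qed.

(** Upper semicontinuity in the uniform sense: values violating it at points
    tending to [x] would be bounded, and a limit of them would lie in [F x]. *)
Lemma osc_near F (x : V) (rho : R) : outer_semicontinuous F -> locally_bounded F ->
  0 < rho -> exists2 eta, 0 < eta & forall x' y', `|x' - x| <= eta -> F x' y' ->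
    fattening (F x) rho y'.
Proof.
move=> osc lbF r0; apply: contrapT => neta.
have {}neta k : exists xy : V * V, [/\ `|xy.1 - x| <= k.+1%:R^-1, F xy.1 xy.2 &
    ~ fattening (F x) rho xy.2].
  apply: contrapT => nxy; apply: neta; exists k.+1%:R^-1; first exact: invS_gt0.
  by move=> x' y' xx' Fxy; apply: contrapT => nf; apply: nxy; exists (x', y').
have /choice[xy xyP] := neta.
have xyx : (fun k => (xy k).1) @ \oo --> x.
  by apply: near_cvg => k; have [] := xyP k.
have [B FB] := locally_bounded_on_balls (`|x| + 1) lbF.
have [|||e [_ [_ [y0 [he _ _ ye]]]]] :=
  @bounded_subseq R n (fun=> B) (fun=> 0) (fun k => (xy k).2) `|B| 0.
- by [].
- by [].
- move=> k; have [xk Fk _] := xyP k.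
  apply: (le_trans (FB _ _ _ Fk)); last exact: ler_norm.
  rewrite -[(xy k).1](subrK x) (le_trans (ler_normD _ _))// addrC lerD2l.
  by rewrite (le_trans xk)// invf_le1// ler1n.
have Fxy0 : F x y0.
  apply: (osc (fun k => (xy (e k)).1) (fun k => (xy (e k)).2)) => //.
    exact: cvg_comp (increasing_cvg he) xyx.
  by move=> k; have [] := xyP (e k).
have /cvgrPdist_le/(_ _ r0)[N _ /(_ N (leqnn N)) yN] := ye.
have [_ _] := xyP (e N); apply; exists y0 => //.
by rewrite distrC.
Qed.

End set_valued_maps.

Section inflation.
Context {R : realType} {n : nat}.
Variable H : hybrid_data R n.
Notation V := 'rV[R]_n.

(** The inflated flow map is built from a closed convex hull, so it is
    controlled by any convex set containing the original velocities nearby; the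
    radius [r] only pays for the closure. *)
Lemma inflation_flow_map_sub (eps r : R) (y w : V) (K : set V) : 0 < r ->
  @convex_set R V K ->
  (forall z v, flow_set H z -> `|z - y| <= eps -> flow_map H z v -> K v) ->
  flow_map (inflation H eps) y w -> fattening K (r + eps) w.
Proof.
move=> r0 cK subK [d hull [b be <-]].
apply: fatteningD; exists d; last first.
  by rewrite addrC addKr (le_trans (norm_le_enorm _)).
apply: closure_fattening => //; apply: (closure_subset _ hull).
apply: smallest_sub => // v [z [[_ -> [c ce <-]] Cz] Fzv].
by apply: subK Cz _ Fzv; rewrite addrC addKr (le_trans (norm_le_enorm _)).
Qed.

Hypothesis HBC : hybrid_basic_conditions H.

Lemma inflation_flow_map_bounded (M : R) : exists B, forall eps y w,
  eps <= 1 -> `|y| <= M -> flow_map (inflation H eps) y w -> `|w| <= B.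
Proof.
have [_ [_ lbF] _ _ _] := HBC.
have [B FB] := locally_bounded_on_balls (M + 1) lbF.
exists (B + (1 + 1)) => eps y w e1 yM Fw.
have := inflation_flow_map_sub ltr01 (norm_ball_convex (B := B)) _ Fw.
case=> [z v _ zy Fzv|v vB wv].
  apply: FB Fzv.
  by rewrite -(subrK y z) (le_trans (ler_normD _ _))// addrC lerD// (le_trans zy).
rewrite -(subrK v w) (le_trans (ler_normD _ _))// addrC lerD//.
by rewrite (le_trans wv)// lerD2l.
Qed.

(** [F x] is convex because [x] belongs to the flow set, so a neighbourhood of
    it may serve as the convex set of [inflation_flow_map_sub]. *)
Lemma inflation_flow_map_near (x : V) (rho : R) : flow_set H x -> 0 < rho ->
  exists2 eta, 0 < eta & forall eps y w, eps <= eta -> `|y - x| <= eta ->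
    flow_map (inflation H eps) y w -> fattening (flow_map H x) rho w.
Proof.
move=> Cx r0; have [_ [osc lbF] _ CF _] := HBC.
have r30 : 0 < rho / 3 by rewrite divr_gt0.
have [eta eta0 etaP] := osc_near x osc lbF r30.
exists (Num.min (eta / 2) (rho / 3)); first by rewrite lt_min r30 divr_gt0.
move=> eps y w; rewrite !le_min => /andP[e1 e2] /andP[yx _] Fw.
have [_ cF] := CF _ Cx.
have := inflation_flow_map_sub r30 (convex_fattening (r := rho / 3) cF) _ Fw.
move=> /(_ _)/fatteningD wF; apply: fatteningS (wF _); first lra.
move=> z v Cz zy; apply: etaP.
by rewrite (le_trans (ler_distD y _ _))//; lra.
Qed.

End inflation.

(** * Hybrid time domains *)

Section hybrid_time.
Context {R : realType}.
Implicit Types E : set (R * nat).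

(** The shape of a hybrid time domain, in terms of its points: each horizontal
    section is an interval, and consecutive sections meet at a jump time. In
    this form the conditions are stable under limits and tails. *)
Record staircase E : Prop := Staircase {
  stair0 : E (0, 0%N);
  stair_ge0 : forall t j, E (t, j) -> 0 <= t;
  stair_convex : forall j s t u, E (s, j) -> E (u, j) -> s <= t <= u -> E (t, j);
  stair_step : forall t j, E (t, j.+1) -> exists s, [/\ s <= t, E (s, j) & E (s, j.+1)];
  stair_mono : forall s t j, E (s, j) -> E (t, j.+1) -> s <= t }.

Definition unbounded_time E := forall M : R, exists2 p, E p & M < p.1 + p.2%:R.

Lemma hybrid_time_domain_staircase E : hybrid_time_domain E -> staircase E.
Proof.
move=> [K [cK K_S ->]].
have Kle k l : (k <= l)%N -> K k `<=` K l.
  move=> /subnK <-; elim: (l - k)%N => //= m IH.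
  by apply: subset_trans IH _; rewrite addSn; exact: K_S.
have common p q : (\bigcup_k K k) p -> (\bigcup_k K k) q -> exists2 k, K k p & K k q.
  move=> [k _ kp] [l _ lq]; exists (maxn k l).
    by apply: Kle kp; rewrite leq_maxl.
  by apply: Kle lq; rewrite leq_maxr.
have itv k t j : K k (t, j) -> exists J (T : nat -> R),
    [/\ (j < J)%N, T 0%N = 0, forall i, (i < J)%N -> T i <= T i.+1 &
      forall s i, K k (s, i) <-> (i < J)%N /\ T i <= s <= T i.+1].
  have [J [T [J1 T0 TS ->]]] := cK k.
  have KP s i : (\bigcup_(i in [set i | (i < J)%N])
        ([set` `[T i, T i.+1]] `*` [set i])) (s, i)
      <-> (i < J)%N /\ T i <= s <= T i.+1.
    split=> [[l /= lJ [/= + ->]]|[iJ sT]]; first by rewrite in_itv.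
    by exists i => //; split; rewrite //= in_itv.
  by move=> /KP[jJ _]; exists J, T.
have K0 k : K k (0, 0%N).
  have [J [T [J1 T0 TS ->]]] := cK k; exists 0%N => //; split => //=.
  by rewrite in_itv/= T0 lexx -T0 TS.
split.
- by exists 0%N.
- move=> t j [k _ Ktj]; have [J [T [jJ T0 TS KP]]] := itv _ _ _ Ktj.
  move/KP : Ktj => [_ /andP[+ _]]; apply: le_trans; rewrite -T0.
  elim: j jJ => // j IH jJ; have jJ' := ltnW jJ.
  by apply: le_trans (IH jJ') _; exact: TS.
- move=> j s t u Es Eu /andP[st tu]; have [k Ks Ku] := common _ _ Es Eu.
  have [J [T [_ _ _ KP]]] := itv _ _ _ Ks; exists k => //.
  move/KP : Ks => [jJ /andP[Ts _]]; move/KP : Ku => [_ /andP[_ uT]].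
  by apply/KP; split=> //; rewrite (le_trans Ts)// (le_trans tu).
- move=> t j [k _ Kt]; have [J [T [jJ _ TS KP]]] := itv _ _ _ Kt.
  move/KP : Kt => [_ /andP[Tt _]]; have jJ' := ltnW jJ.
  exists (T j.+1); split => //; exists k => //; apply/KP; split => //.
    by rewrite lexx TS.
  by rewrite lexx TS.
- move=> s t j Es Et; have [k Ks Kt] := common _ _ Es Et.
  have [J [T [_ _ _ KP]]] := itv _ _ _ Ks.
  move/KP : Ks => [_ /andP[_ sT]]; move/KP : Kt => [_ /andP[Tt _]].
  exact: le_trans Tt.
Qed.

Section staircase_theory.
Variable E : set (R * nat).
Hypothesis sE : staircase E.

Lemma staircase_le s i t j : (i < j)%N -> E (s, i) -> E (t, j) -> s <= t.
Proof.
move=> + Es; elim: j t => // j IH t; rewrite ltnS leq_eqVlt => /orP[/eqP <-|ij] Et.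
  exact: (stair_mono sE Es Et).
have [u [ut Eu _]] := stair_step sE Et.
by rewrite (le_trans _ ut)// IH.
Qed.

(** Hybrid time [t + j] increases continuously along flows and by one at jumps,
    so it cannot skip a window of length one. *)
Lemma staircase_window (M : R) : unbounded_time E -> 0 <= M ->
  exists t j, E (t, j) /\ M <= t + j%:R <= M + 1.
Proof.
move=> uE M0; have [[t j] /= Etj /ltW Mtj] := uE M.
elim: j t Etj Mtj => [|j IH] t Et Mt.
  exists M, 0%N; split; last by rewrite mulr0n addr0 lexx lerDl ler01.
  by apply: (stair_convex sE (stair0 sE) Et); rewrite M0; move: Mt; rewrite mulr0n addr0.
have [s [st Ej Ej1]] := stair_step sE Et.
have [Ms|sM] := leP M (s + j%:R); first exact: IH Ej Ms.
have jE : j.+1%:R = j%:R + 1 :> R by rewrite -natr1.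
have [Ms1|s1M] := leP M (s + j.+1%:R).
  by exists s, j.+1; split=> //; move: Ms1; rewrite jE; lra.
exists (M - j.+1%:R), j.+1; split; last by rewrite subrK lexx lerDl ler01.
by apply: (stair_convex sE Ej1 Et); move: Mt s1M; rewrite jE; lra.
Qed.

Lemma staircase_tail s i : E (s, i) ->
  staircase [set p | 0 <= p.1 /\ E (s + p.1, (i + p.2)%N)].
Proof.
move=> Esi; split.
- by rewrite /= addr0 addn0.
- by move=> t j [].
- move=> j r t u [/= r0 Er] [_ Eu] /andP[rt tu]; split=> /=.
    exact: le_trans rt.
  by apply: (stair_convex sE Er Eu); rewrite !lerD2l rt.
- move=> t j [/= t0]; rewrite addnS => Et.
  have [u [ut Ej Ej1]] := stair_step sE Et.
  have su : s <= u by apply: staircase_le Esi Ej1; rewrite ltnS leq_addr.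
  exists (u - s); split; first by rewrite lerBlDl.
  + by split; rewrite /= ?subr_ge0// subrKC.
  + split=> [|/=]; last by rewrite subrKC.
    by rewrite subr_ge0.
- move=> r t j [/= _ Er] [_ /=]; rewrite addnS => Et.
  by have := stair_mono sE Er Et; rewrite lerD2l.
Qed.

Lemma unbounded_time_tail s i : unbounded_time E -> E (s, i) ->
  unbounded_time [set p | 0 <= p.1 /\ E (s + p.1, (i + p.2)%N)].
Proof.
move=> uE Esi M; have [[t j] /= Et Mt] := uE (s + i%:R + `|M|).
have M0 := normr_ge0 M; have MM := ler_norm M.
have ij : (i <= j)%N.
  rewrite leqNgt; apply/negP => ji; have ts := staircase_le ji Et Esi.
  have : j%:R <= i%:R :> R by rewrite ler_nat ltnW.
  lra.
have st : s <= t.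
  move: ij; rewrite leq_eqVlt => /orP[/eqP ijE|ij]; last exact: staircase_le Esi Et.
  by move: Mt; rewrite ijE; lra.
exists (t - s, (j - i)%N) => /=; first by rewrite subr_ge0 subrKC subnKC.
by rewrite natrB//; lra.
Qed.

(** If jumps never stop, the first [k] steps of the staircase exhaust it; if
    [m] is the last index, its section is a half-line, which is exhausted by
    segments of length [k]. *)
Lemma staircase_hybrid_time_domain : unbounded_time E -> hybrid_time_domain E.
Proof.
move=> uE.
have E0 := stair0 sE.
have step j : exists s, forall t, E (t, j.+1) -> [/\ s <= t, E (s, j) & E (s, j.+1)].
  have [[t Et]|nE] := pselect (exists t, E (t, j.+1)).
    have [s [st Ej Ej1]] := stair_step sE Et; exists s => u Eu; split => //.
    exact: (stair_mono sE Ej Eu).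
  by exists 0 => t Et; exfalso; apply: nE; exists t.
have /choice[S SP] := step.
(* [T i] is the time at which the section [i] starts *)
pose T i := if i is i'.+1 then S i' else 0.
have TE i t : E (t, i) -> E (T i, i) /\ T i <= t.
  case: i => [|i] Et /=; first by split=> //; exact: (stair_ge0 sE Et).
  by have [] := SP _ _ Et.
have TS i t : E (t, i.+1) -> E (T i.+1, i) /\ T i <= T i.+1.
  by move=> /SP[_ Ei _]; split => //; have [] := TE _ _ Ei.
have [allj|/existsNP[J nJ]] := pselect (forall j, exists t, E (t, j)).
  exists (fun k => \bigcup_(i in [set i | (i < k.+1)%N])
    ([set` `[T i, T i.+1]] `*` [set i])).
  split.
  - move=> k; exists k.+1, T; split => // i _.
    by have [t Et] := allj i.+1; have [] := TS _ _ Et.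
  - by move=> k [t j] [i /= ik [Tt ji]]; exists i => //=; exact: leqW.
  - apply/seteqP; split=> [[t j] Et|[t j] [k _ [i _ [/= Tt ->]]]].
      exists j => //; exists j => //=; split => //=; rewrite in_itv/=.
      have [_ -> /=] := TE _ _ Et.
      by have [u /SP[_ _ ES]] := allj j.+1; exact: (stair_mono sE Et ES).
    have [u Eu] := allj i.+1; have [Ei1 _] := TS _ _ Eu.
    have [Ei _] := TE _ _ Ei1; apply: (stair_convex sE Ei Ei1).
    by move: Tt; rewrite in_itv.
have down i j t : (i <= j)%N -> E (t, j) -> exists s, E (s, i).
  elim: j t => [|j IH] t; first by rewrite leqn0 => /eqP -> Et; exists t.
  rewrite leq_eqVlt => /orP[/eqP ->|ij] Et; first by exists t.
  by have [s [_ /(IH _ ij)]] := stair_step sE Et.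
have [m [t0 Em] mmax] : exists2 m, (exists t, E (t, m)) &
    forall t j, E (t, j) -> (j <= m)%N.
  elim: J nJ => [nJ|J IH nJ]; first by exfalso; apply: nJ; exists 0.
  have [[t Et]|] := pselect (exists t, E (t, J)); last exact: IH.
  exists J; first by exists t.
  move=> u j Eu; rewrite leqNgt; apply/negP => Jj; apply: nJ.
  exact: down Jj Eu.
have Emy t : T m <= t -> E (t, m).
  move=> Tt; have [ETm _] := TE _ _ Em.
  have [[u j] /= Eu tu] := uE (t + m%:R).
  have [Eu' tu'] : E (u, j) /\ t <= u.
    split=> //; have : j%:R <= m%:R :> R by rewrite ler_nat; exact: mmax Eu.
    lra.
  have jm := mmax _ _ Eu; move: jm; rewrite leq_eqVlt => /orP[/eqP jm|jm].
    by rewrite jm in Eu; apply: (stair_convex sE ETm Eu); rewrite Tt.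
  have uT := staircase_le jm Eu ETm.
  by have -> : t = T m by apply/eqP; rewrite eq_le Tt (le_trans tu').
pose T' k i := if (i <= m)%N then T i else T m + k%:R.
exists (fun k => \bigcup_(i in [set i | (i < m.+1)%N])
  ([set` `[T' k i, T' k i.+1]] `*` [set i])).
have lem k i : (i < m.+1)%N -> T' k i <= T' k i.+1.
  rewrite ltnS /T' => im; rewrite im; case: ltnP => [im'|mi].
    by have [t Et] := down _ _ _ im' Em; have [] := TS _ _ Et.
  have -> : i = m by apply/eqP; rewrite eqn_leq im.
  by rewrite lerDl.
split.
- by move=> k; exists m.+1, (T' k); split => //; exact: lem.
- move=> k [t j] [i /= im [/= Tt ji]]; exists i => //; split => //=.
  move: Tt; rewrite !in_itv/= /T'; move: im; rewrite ltnS => im; rewrite im.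
  case: ifP => // _ /andP[-> tT]/=; apply: (le_trans tT).
  by rewrite lerD2l ler_nat.
- apply/seteqP; split=> [[t j] Et|[t j] [k _ [i /= im [/= Tt ->]]]].
    have jm := mmax _ _ Et; have [_ Tt] := TE _ _ Et.
    exists (Num.bound (t - T m)) => //; exists j => //=; split => //=.
    rewrite in_itv/= /T' jm Tt/=; case: ltnP => [jm'|mj].
      have [u /SP[_ _ ES]] := down _ _ _ jm' Em.
      exact: (stair_mono sE Et ES).
    have jE : j = m by apply/eqP; rewrite eqn_leq jm.
    by rewrite -lerBlDl ltW// archi_boundP// subr_ge0 -jE.
  move: Tt; rewrite in_itv/= /T'; move: im; rewrite ltnS => im; rewrite im.
  move=> /andP[Tt tT]; move: im tT; rewrite leq_eqVlt => /orP[/eqP im _|im].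
    by rewrite im in Tt *; exact: Emy.
  rewrite im => tT.
  have [u Eu] := down _ _ _ im Em; have [Ei1 _] := TS _ _ Eu.
  by have [Ei _] := TE _ _ Ei1; apply: (stair_convex sE Ei Ei1); rewrite Tt.
Qed.

End staircase_theory.

End hybrid_time.

(** * Graphical limits of hybrid maps that are asymptotically equi-Lipschitz *)

Lemma natr_cvg (R : realType) (j : nat -> nat) (y : R) :
  (fun k => (j k)%:R) @ \oo --> y ->
  exists j0, y = j0%:R /\ \forall k \near \oo, j k = j0.
Proof.
move=> jy; have h0 : (0 : R) < 1 / 2 by rewrite divr_gt0.
have /cvgrPdist_lt/(_ _ h0)[N _ jN] := jy.
have jE k : (N <= k)%N -> j k = j N.
  move=> Nk; have /= := jN _ Nk; have /= := jN N (leqnn N).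
  rewrite !ltr_norml => H1 H2.
  have H3 : (j k)%:R < (j N).+1%:R :> R by rewrite -natr1; lra.
  have H4 : (j N)%:R < (j k).+1%:R :> R by rewrite -natr1; lra.
  by move: H3 H4; rewrite !ltr_nat !ltnS => ? ?; apply/eqP; rewrite eqn_leq; apply/andP.
exists (j N); split; last by exists N.
apply: (cvg_unique (@norm_hausdorff _ R) jy).
apply: cvg_near_cst; exists N => // k Nk; by rewrite (jE k Nk).
Qed.

Lemma cvg_pair_seq (T U : topologicalType) (x : nat -> T) (y : nat -> U)
    (a : T) (b : U) :
  x @ \oo --> a -> y @ \oo --> b -> (fun k => (x k, y k)) @ \oo --> (a, b).
Proof. by move=> xa yb; exact: cvg_pair. Qed.

Lemma cvg_seq_bounded (R : realType) (s : nat -> R) (t : R) : s @ \oo --> t ->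
  \forall k \near \oo, `|s k| <= `|t| + 1.
Proof. by move=> /cvg_norm st; apply: (cvgr_le _ st); rewrite ltrDl. Qed.

Lemma lipschitz_within_continuous (R : realType) n (f : R -> 'rV[R]_n) (a b l : R) :
  (forall x y, a <= x <= b -> a <= y <= b -> `|f x - f y| <= l * `|x - y|) ->
  {within `[a, b], continuous f}.
Proof.
move=> lip; apply/subspace_continuousP => x /=; rewrite in_itv/= => xab.
apply/cvgrPdist_le => e e0.
have l10 : 0 < `|l| + 1 by rewrite ltr_wpDl.
have := nbhsx_ballx x _ (divr_gt0 e0 l10).
rewrite near_withinE; apply: filterS => y /ltW xy /=; rewrite in_itv/= => yab.
rewrite (le_trans (lip _ _ xab yab))//.
rewrite (@le_trans _ _ ((`|l| + 1) * `|x - y|))//.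
  by rewrite ler_wpM2r// (le_trans (ler_norm _))// lerDl.
by rewrite mulrC -ler_pdivlMr.
Qed.

Lemma lipschitz_absolutely_continuous_on (R : realType) n (f : R -> 'rV[R]_n)
    (a b l : R) :
  (forall x y, a <= x <= b -> a <= y <= b -> `|f x - f y| <= l * `|x - y|) ->
  absolutely_continuous_on f a b.
Proof.
move=> lip e e0; pose c : R := n%:R * `|l| + 1.
have c0 : 0 < c by rewrite ltr_wpDl// mulr_ge0.
exists (e / c); first by rewrite divr_gt0.
move=> m u v uv _; rewrite ltr_pdivlMr// mulrC => /(le_lt_trans _); apply.
rewrite mulr_sumr; apply: ler_sum => i _; have [au [uvi vb]] := uv i.
apply: le_trans (enorm_le_norm _) _.
apply: (@le_trans _ _ (n%:R * (`|l| * (v i - u i)))).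
  rewrite ler_wpM2l//.
  apply: (@le_trans _ _ (l * `|v i - u i|)).
    by apply: lip; apply/andP; split => //; [exact: le_trans uvi|exact: le_trans vb].
  by rewrite ger0_norm ?subr_ge0// ler_wpM2r ?subr_ge0// ler_norm.
by rewrite mulrA ler_wpM2r ?subr_ge0// /c lerDl.
Qed.

Section graphical_limit.
Context {R : realType} {n : nat}.
Variables (phi : nat -> hybrid_map R n) (L : R * R -> set 'rV[R]_n) (M l : R).
Hypothesis stair_phi : forall k, staircase (hdom (phi k)).
Hypothesis unbounded_phi : forall k, unbounded_time (hdom (phi k)).
Hypothesis bounded_phi : forall k t j, hdom (phi k) (t, j) -> `|hval (phi k) t j| <= M.
(* The error [eta] leaves room for maps that are only close to Lipschitz ones. *)
Hypothesis lip_phi : forall T eta, 0 < eta -> \forall k \near \oo,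
  forall j s t, hdom (phi k) (s, j) -> hdom (phi k) (t, j) ->
    s + j%:R <= T -> t + j%:R <= T ->
    `|hval (phi k) s j - hval (phi k) t j| <= l * `|s - t| + eta.
Hypothesis cvg_phi : graphical_cvg (fun k => set_valued (phi k)) L.

(** The limit is an inner limit of graphs, and natural numbers that converge
    are eventually constant; so the discrete component can be fixed. *)
Lemma limit_approx p x : L p x -> exists j (s : nat -> R),
  [/\ p.2 = j%:R, s @ \oo --> p.1,
      \forall k \near \oo, hdom (phi k) (s k, j) &
      (fun k => hval (phi k) (s k) j) @ \oo --> x].
Proof.
move=> Lpx; have [inner _] := cvg_phi.
have : gph L (p, x) by [].
rewrite -inner => -[z zgph zcvg].
have z1 : (fun k => (z k).1) @ \oo --> p by apply: cvg_comp zcvg cvg_fst.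
have z2 : (fun k => (z k).2) @ \oo --> x by apply: cvg_comp zcvg cvg_snd.
have z11 : (fun k => (z k).1.1) @ \oo --> p.1.
  by case: p {Lpx zcvg} z1 => p1 p2 z1; apply: cvg_comp z1 cvg_fst.
have z12 : (fun k => (z k).1.2) @ \oo --> p.2.
  by case: p {Lpx zcvg z11} z1 => p1 p2 z1; apply: cvg_comp z1 cvg_snd.
have /choice[j jP] : forall k, exists j, gph (set_valued (phi k)) (z k) ->
    [/\ (z k).1.2 = j%:R, hdom (phi k) ((z k).1.1, j) &
      (z k).2 = hval (phi k) (z k).1.1 j].
  move=> k; have [[j H]|nz] := pselect (gph (set_valued (phi k)) (z k)).
    by exists j.
  by exists 0%N => /nz.
have jcvg : (fun k => (j k)%:R) @ \oo --> p.2.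
  apply: cvg_trans z12; apply: near_eq_cvg.
  by apply: filterS zgph => k /jP[].
have [j0 [pj0 jj0]] := natr_cvg jcvg.
exists j0, (fun k => (z k).1.1); split => //.
  by apply: filterS2 jj0 zgph => k <- /jP[].
apply: cvg_trans z2; apply: near_eq_cvg.
by apply: filterS2 jj0 zgph => k <- /jP[].
Qed.

Definition limit_dom : set (R * nat) := [set p | exists x, L (p.1, p.2%:R) x].

(** Bounded values along the given times have a convergent subsequence, whose
    limit belongs to the outer limit of the graphs. *)
Lemma limit_dom_outer (e : nat -> nat) (s : nat -> R) (t : R) (j : nat) :
  {homo e : k l / (k < l)%N} -> (forall k, hdom (phi (e k)) (s k, j)) ->
  s @ \oo --> t -> limit_dom (t, j).
Proof.
move=> he sE st.
have [N _ sN] := cvg_seq_bounded st.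
pose x k := hval (phi (e (k + N)%N)) (s (k + N)%N) j.
have [|||f [_ [_ [x0 [hf _ _ xx0]]]]] :=
  @bounded_subseq R n (fun=> M) (fun=> 0%N) x `|M| 0.
- by [].
- by [].
- by move=> k; apply: le_trans (bounded_phi (sE _)) _; exact: ler_norm.
exists x0; have [_ outer] := cvg_phi.
rewrite -[L _ x0]/(gph L ((t, j%:R), x0)) -outer.
exists (fun k => e (f k + N))%N, (fun k => ((s (f k + N)%N, j%:R), x (f k))).
split.
- by move=> k m km; apply: he; rewrite ltn_add2r; exact: hf.
- by move=> k; exists j; split => //=; exact: sE.
- apply: cvg_pair_seq => //; apply: cvg_pair_seq; last exact: cvg_cst.
  have hfN : {homo (fun k => f k + N)%N : k l / (k < l)%N}.
    by move=> k m /hf; rewrite ltn_add2r.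
  exact: cvg_comp (increasing_cvg hfN) st.
Qed.

Lemma limit_dom_subseq (t : nat -> R) (j : nat -> nat) (B : R) (J : nat) :
  (\forall k \near \oo, [/\ hdom (phi k) (t k, j k), `|t k| <= B & (j k <= J)%N]) ->
  exists (e : nat -> nat) (t0 : R) (j0 : nat), [/\ {homo e : k l / (k < l)%N},
    forall k, hdom (phi (e k)) (t (e k), j0) /\ j (e k) = j0, t \o e @ \oo --> t0 &
    limit_dom (t0, j0)].
Proof.
move=> [N _ NP].
have NPk k : [/\ hdom (phi (k + N)%N) (t (k + N)%N, j (k + N)%N),
    `|t (k + N)%N| <= B & (j (k + N) <= J)%N].
  by apply: NP; rewrite /= leq_addl.
have [|||e [t0 [j0 [_ [he je te _]]]]] := @bounded_subseq R n
  (fun k => t (k + N)%N) (fun k => j (k + N)%N) (fun=> 0) `|B| J.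
- by move=> k; have [_ tB _] := NPk k; rewrite (le_trans tB)// ler_norm.
- by move=> k; have [] := NPk k.
- by move=> k; rewrite normr0.
have homo_e : {homo (fun k => e k + N)%N : k l / (k < l)%N}.
  by move=> k m /he; rewrite ltn_add2r.
have tE k : hdom (phi (e k + N)%N) (t (e k + N)%N, j0).
  by rewrite -(je k); have [] := NPk (e k).
exists (fun k => e k + N)%N, t0, j0; split => //.
exact: limit_dom_outer homo_e tE te.
Qed.

Lemma limit_lipschitz t t' j x x' : L (t, j%:R) x -> L (t', j%:R) x' ->
  `|x - x'| <= l * `|t - t'|.
Proof.
move=> /limit_approx[j1 [s [/= /eqP + st sE sx]]].
rewrite eqr_nat => /eqP jE; rewrite -{j1}jE in sE sx.
move=> /limit_approx[j1 [s' [/= /eqP + st' sE' sx']]].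
rewrite eqr_nat => /eqP jE; rewrite -{j1}jE in sE' sx'.
apply/ler_addgt0Pl => eta eta0.
have cl : (fun k => `|hval (phi k) (s k) j - hval (phi k) (s' k) j|) @ \oo --> `|x - x'|.
  by apply: cvg_norm; exact: cvgB.
have cr : (fun k => eta + l * `|s k - s' k|) @ \oo --> eta + l * `|t - t'|.
  apply: cvgD; first exact: cvg_cst.
  by apply: cvgM; [exact: cvg_cst|]; apply: cvg_norm; exact: cvgB.
apply: (ler_cvg_to cl cr).
have st1 : \forall k \near \oo, s k <= t + 1.
  by apply: (cvgr_le _ st); rewrite ltrDl.
have st1' : \forall k \near \oo, s' k <= t' + 1.
  by apply: (cvgr_le _ st'); rewrite ltrDl.
pose T := Num.max (t + 1) (t' + 1) + j%:R.
near=> k; rewrite [leRHS]addrC.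
have lipk : forall i s t, hdom (phi k) (s, i) -> hdom (phi k) (t, i) ->
    s + i%:R <= T -> t + i%:R <= T ->
    `|hval (phi k) s i - hval (phi k) t i| <= l * `|s - t| + eta.
  by near: k; exact: lip_phi.
apply: lipk.
- by near: k.
- by near: k.
- by rewrite lerD2r le_max; apply/orP; left; near: k.
- by rewrite lerD2r le_max; apply/orP; right; near: k.
Unshelve. all: by end_near. Qed.

(** The values converge along some sequence of times by [limit_approx]; the
    asymptotic Lipschitz bound transfers this to any other sequence of times with
    the same limit. *)
Lemma limit_value t j x (s : nat -> R) : L (t, j%:R) x -> s @ \oo --> t ->
  (\forall k \near \oo, hdom (phi k) (s k, j)) ->
  (fun k => hval (phi k) (s k) j) @ \oo --> x.
Proof.
move=> /limit_approx[j1 [s' [/= /eqP + st' sE' sx']]] st sE.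
rewrite eqr_nat => /eqP jE; rewrite -{j1}jE in sE' sx'.
suff d0 : (fun k => hval (phi k) (s k) j - hval (phi k) (s' k) j) @ \oo -->
    (0 : 'rV[R]_n).
  rewrite -[x]add0r.
  apply: cvg_trans (cvgD d0 sx'); apply: near_eq_cvg; near=> k.
  by rewrite /GRing.add/= subrK.
apply/cvgrPdist_le => e e0; have e20 : 0 < e / 2 by rewrite divr_gt0.
have cs : (fun k => l * `|s k - s' k|) @ \oo --> (0 : R).
  have -> : 0 = l * `|t - t| by rewrite subrr normr0 mulr0.
  by apply: cvgM; [exact: cvg_cst|]; apply: cvg_norm; exact: cvgB.
have st1 : \forall k \near \oo, s k <= t + 1.
  by apply: (cvgr_le _ st); rewrite ltrDl.
have st1' : \forall k \near \oo, s' k <= t + 1.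
  by apply: (cvgr_le _ st'); rewrite ltrDl.
have cs2 : \forall k \near \oo, l * `|s k - s' k| <= e / 2.
  by apply: (cvgr_le _ cs).
near=> k; rewrite sub0r normrN.
apply: (@le_trans _ _ (l * `|s k - s' k| + e / 2)).
  have lipk : forall i s u, hdom (phi k) (s, i) -> hdom (phi k) (u, i) ->
      s + i%:R <= t + 1 + j%:R -> u + i%:R <= t + 1 + j%:R ->
      `|hval (phi k) s i - hval (phi k) u i| <= l * `|s - u| + e / 2.
    by near: k; exact: lip_phi.
  apply: lipk.
  - by near: k.
  - by near: k.
  - by rewrite lerD2r; near: k.
  - by rewrite lerD2r; near: k.
rewrite [leRHS](splitr e) lerD2r.
by near: k.
Unshelve. all: by end_near. Qed.

Lemma limit_dom_approx t j : limit_dom (t, j) -> exists2 s : nat -> R,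
  s @ \oo --> t & \forall k \near \oo, hdom (phi k) (s k, j).
Proof.
move=> [x /limit_approx[j1 [s [/= /eqP + st sE _]]]].
by rewrite eqr_nat => /eqP jE; exists s => //; rewrite jE.
Qed.

(** Order relations between points pass to the limit, and a time strictly
    between two limit times is eventually between their approximations. Only the
    jump time below a given point has to be produced, as a limit point of jump
    times of the approximations. *)
Lemma limit_dom_staircase : staircase limit_dom.
Proof.
split.
- have [|e [t0 [j0 [_ je te Lt0]]]] := @limit_dom_subseq (fun=> 0) (fun=> 0%N) 0 0.
    by near=> k; split => //; [exact: (stair0 (stair_phi k))|rewrite normr0].
  have t00 : t0 = 0.
    by apply: (cvg_unique (@norm_hausdorff _ R) te); exact: cvg_cst.
  by have [_ j00] := je 0%N; move: Lt0; rewrite t00 -j00.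
- move=> t j /limit_dom_approx[s st sE].
  apply: (ler_cvg_to (cvg_cst 0) st); apply: filterS sE => k Ek.
  exact: (stair_ge0 (stair_phi k) Ek).
- move=> j s t u Es Eu /andP[st tu].
  have [<-//|] := eqVneq s t; have [->//|] := eqVneq t u => tu' st'.
  have {tu'}tu : t < u by rewrite lt_neqAle tu'.
  have {st'}st : s < t by rewrite lt_neqAle st'.
  have [s' ss' sE] := limit_dom_approx Es; have [u' uu' uE] := limit_dom_approx Eu.
  have [|e [t0 [j0 [_ je te Lt0]]]] := @limit_dom_subseq (fun=> t) (fun=> j) `|t| j.
    near=> k; split => //; apply: (@stair_convex _ _ (stair_phi k) _ (s' k) _ (u' k)).
    + by near: k.
    + by near: k.
    + by apply/andP; split; near: k; [exact: (cvgr_le _ ss')|exact: (cvgr_ge _ uu')].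
  have t0t : t0 = t.
    by apply: (cvg_unique (@norm_hausdorff _ R) te); exact: cvg_cst.
  by have [_ jj0] := je 0%N; move: Lt0; rewrite t0t -jj0.
- move=> t j /limit_dom_approx[s st sE].
  have /choice[r rP] : forall k, exists r, hdom (phi k) (s k, j.+1) ->
      [/\ r <= s k, hdom (phi k) (r, j) & hdom (phi k) (r, j.+1)].
    move=> k; have [H|] := pselect (hdom (phi k) (s k, j.+1)); last by exists 0.
    by have [r ?] := stair_step (stair_phi k) H; exists r.
  have sB := cvg_seq_bounded st.
  have rB : \forall k \near \oo, [/\ hdom (phi k) (r k, j), hdom (phi k) (r k, j.+1),
      r k <= s k & `|r k| <= `|t| + 1].
    apply: filterS2 sE sB => k Es sb; have [rs r1 r2] := rP _ Es; split => //.
    rewrite ger0_norm ?(stair_ge0 (stair_phi k) r1)//.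
    by rewrite (le_trans rs)// (le_trans (ler_norm _)).
  have [|e [t0 [j0 [he je te Lt0]]]] := @limit_dom_subseq r (fun=> j) (`|t| + 1) j.
    by apply: filterS rB => k [].
  have jj0 : j = j0 by have [_] := je 0%N.
  exists t0; split; last 2 first.
  + by rewrite jj0.
  + have [N _ NP] := rB.
    have homo_e : {homo (fun k => e (k + N)%N) : k l / (k < l)%N}.
      by move=> k m km; apply: he; rewrite ltn_add2r.
    apply: (limit_dom_outer homo_e (s := fun k => r (e (k + N)%N))).
      move=> k; have [] // := NP (e (k + N)%N); rewrite /=.
      apply: leq_trans (leq_addl k N) _.
      elim: (k + N)%N => // m IH; apply: leq_ltn_trans IH _; exact: he.
    exact: (cvg_comp _ _ (cvg_addnr N) te).
  + apply: (ler_cvg_to te (cvg_comp _ _ (increasing_cvg he) st)).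
    have rs : \forall k \near \oo, r k <= s k by apply: filterS rB => k [].
    exact: (increasing_cvg he rs).
- move=> s t j Es Et.
  have [s' ss' sE] := limit_dom_approx Es; have [t' tt' tE] := limit_dom_approx Et.
  apply: (ler_cvg_to ss' tt'); apply: filterS2 sE tE => k Ek Ek1.
  exact: (stair_mono (stair_phi k) Ek Ek1).
Unshelve. all: by end_near. Qed.

(** Each approximating domain meets the same bounded window of hybrid time, and
    points taken in that window have a limit point. *)
Lemma limit_dom_unbounded : unbounded_time limit_dom.
Proof.
move=> B; pose B1 := `|B| + 1.
have B10 : 0 <= B1 by rewrite addr_ge0.
have /choice[tj tjP] : forall k, exists p : R * nat, hdom (phi k) p /\
    B1 <= p.1 + p.2%:R <= B1 + 1.
  move=> k; have [t [j [Etj W]]] := staircase_window (stair_phi k) (@unbounded_phi k) B10.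
  by exists (t, j).
pose J := Num.bound (B1 + 1).
have JP : B1 + 1 < J%:R by apply: archi_boundP; rewrite addr_ge0.
have bnd k : [/\ hdom (phi k) ((tj k).1, (tj k).2), `|(tj k).1| <= B1 + 1 &
    ((tj k).2 <= J)%N].
  have [Ek /andP[_ W]] := tjP k.
  have E' : hdom (phi k) ((tj k).1, (tj k).2) by rewrite -surjective_pairing.
  have t0 := stair_ge0 (stair_phi k) E'; have j0 : 0 <= (tj k).2%:R :> R by [].
  split => //; first by rewrite ger0_norm//; lra.
  by rewrite -(ler_nat R); lra.
have [|e [t0 [j0 [_ je te Lt0]]]] :=
  @limit_dom_subseq (fun k => (tj k).1) (fun k => (tj k).2) (B1 + 1) J.
  by near=> k; exact: bnd.
exists (t0, j0) => //=.
apply: (@lt_le_trans _ _ B1); first by rewrite (le_lt_trans (ler_norm _))// ltrDl.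
rewrite -lerBlDr; apply: (ler_cvg_to (cvg_cst _) te); near=> k => /=.
have [_ <-] := je k; rewrite lerBlDr.
by have [_ /andP[]] := tjP (e k).
Unshelve. all: by end_near. Qed.

Definition limit_map : hybrid_map R n :=
  HybridMap limit_dom (fun t j => xget 0 (L (t, j%:R))).

Lemma limit_mapP t j : hdom limit_map (t, j) -> L (t, j%:R) (hval limit_map t j).
Proof. by move=> [x Lx]; apply: (@xgetPex _ 0 (L (t, j%:R))); exists x. Qed.

Lemma limit_map_unique t j x : L (t, j%:R) x -> x = hval limit_map t j.
Proof.
move=> Lx; have Ly : L (t, j%:R) (hval limit_map t j) by apply: limit_mapP; exists x.
have := limit_lipschitz Lx Ly; rewrite subrr normr0 mulr0 normr_le0 subr_eq0.
by move/eqP.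
Qed.

Lemma set_valued_limit_map : L = set_valued limit_map.
Proof.
apply/funext => -[t y]; apply/seteqP; split => [x Lx|x [j [/= -> Ej ->]]].
  have [j [_ [/= yj _ _ _]]] := limit_approx Lx.
  rewrite yj in Lx *; exists j; split => //; first by exists x.
  exact: limit_map_unique.
exact: limit_mapP.
Qed.

Lemma limit_map_lipschitz s t j : hdom limit_map (s, j) -> hdom limit_map (t, j) ->
  `|hval limit_map s j - hval limit_map t j| <= l * `|s - t|.
Proof. by move=> /limit_mapP Ls /limit_mapP Lt; exact: limit_lipschitz Ls Lt. Qed.

Lemma limit_map_arc : hybrid_arc limit_map.
Proof.
have lip j t t' : hdom limit_map (t, j) -> hdom limit_map (t', j) ->
    forall x y, t <= x <= t' -> t <= y <= t' ->
    `|hval limit_map x j - hval limit_map y j| <= l * `|x - y|.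
  move=> Et Et' x y xt yt; apply: limit_map_lipschitz.
    exact: (stair_convex limit_dom_staircase Et Et').
  exact: (stair_convex limit_dom_staircase Et Et').
split; first split.
- exact: staircase_hybrid_time_domain limit_dom_staircase limit_dom_unbounded.
- move=> j t t' Et Et' _; exact: lipschitz_within_continuous (lip _ _ _ Et Et').
- move=> j t t' Et Et' _; exact: lipschitz_absolutely_continuous_on (lip _ _ _ Et Et').
Qed.

End graphical_limit.

(** * Flows of inflated systems *)

Section flows_of_inflation.
Context {R : realType} {n : nat}.
Variable H : hybrid_data R n.
Notation mu := (@lebesgue_measure R).

Lemma solution_flow (phi : hybrid_map R n) (j : nat) (s t : R) : solution H phi ->
  hdom phi (s, j) -> hdom phi (t, j) -> s < t ->
  [/\ forall r, s <= r <= t -> hdom phi (r, j),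
      absolutely_continuous_on (fun r => hval phi r j) s t &
      {ae mu, forall r : R, r \in `[s, t] ->
          [/\ flow_set H (hval phi r j),
              derivable (fun u => hval phi u j) r 1
            & flow_map H (hval phi r j) (derive1 (fun u => hval phi u j) r)]}].
Proof.
move=> [[[htd _] ac] _ flow _] Es Et st.
have stair := hybrid_time_domain_staircase htd.
have seg r : s <= r <= t -> hdom phi (r, j) by exact: (stair_convex stair Es Et).
split=> //; first exact: ac.
by apply: flow => // -[r i] [/= + ->]; rewrite in_itv/=; exact: seg.
Qed.

Lemma solution_mean_value (phi : hybrid_map R n) (j : nat) (s t : R) K :
  solution H phi -> hdom phi (s, j) -> hdom phi (t, j) -> s < t ->
  @convex_set R 'rV[R]_n K ->
  (forall r, s <= r <= t -> flow_map H (hval phi r j) `<=` K) ->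
  closure K ((t - s)^-1 *: (hval phi t j - hval phi s j)).
Proof.
move=> sol Es Et st cK FK.
have [seg ac ae] := solution_flow sol Es Et st.
apply: (@ac_mean_value R n (fun r => hval phi r j)) => //.
move: ae; apply: filterS; first exact: (ae_filter_ringOfSetsType mu).
move=> r rP rst; have [_ dr Fr] := rP rst; split => //.
by apply: FK Fr; move: rst; rewrite in_itv.
Qed.

End flows_of_inflation.

(** The mean value inclusion, with a ball as convex set. *)
Lemma inflated_solution_lipschitz (R : realType) n (H : hybrid_data R n) (M : R) :
  hybrid_basic_conditions H -> exists2 l, 0 <= l &
    forall eps phi j s t, eps <= 1 -> solution (inflation H eps) phi ->
      (forall r, hdom phi (r, j) -> `|hval phi r j| <= M) ->
      hdom phi (s, j) -> hdom phi (t, j) ->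
      `|hval phi s j - hval phi t j| <= l * `|s - t|.
Proof.
move=> HBC; have [B FB] := inflation_flow_map_bounded HBC M.
exists `|B| => // eps phi j s t e1 sol phiM.
wlog st : s t / s < t.
  move=> wl Es Et; have [st|ts|->] := ltgtP s t; first exact: wl.
    by rewrite distrC [in leRHS]distrC; exact: wl.
  by rewrite !subrr !normr0 mulr0.
move=> Es Et; have [seg _ _] := solution_flow sol Es Et st.
have cl := solution_mean_value sol Es Et st (@norm_ball_convex R n B).
have st0 : 0 < t - s by rewrite subr_gt0.
have : `|(t - s)^-1 *: (hval phi t j - hval phi s j)| <= B.
  apply/ler_addgt0Pl => e e0.
  have [|v vB vw] := closure_fattening e0 (cl _).
    by move=> r rst w; apply: FB => //; apply: phiM; exact: seg.
  by rewrite -(subrK v (_ *: _)) (le_trans (ler_normD _ _))// lerD.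
rewrite normrZ gtr0_norm ?invr_gt0// ler_pdivrMl// => H1.
rewrite distrC (le_trans H1)// [`|s - t|]distrC (gtr0_norm st0) mulrC.
by rewrite ler_wpM2r ?ler_norm// ltW.
Qed.

(** * The limit of perturbed solutions is a solution *)

Section limit_solution.
Context {R : realType} {n : nat}.
Variables (H : hybrid_data R n) (phi : nat -> hybrid_map R n).
(* [pert T k] is a perturbation of [phi k] truncated at hybrid time [T]. *)
Variables (pert : R -> nat -> hybrid_map R n) (L : R * R -> set 'rV[R]_n) (M : R).
Notation mu := (@lebesgue_measure R).
Hypothesis HBC : hybrid_basic_conditions H.
Hypothesis stair_phi : forall k, staircase (hdom (phi k)).
Hypothesis unbounded_phi : forall k, unbounded_time (hdom (phi k)).
Hypothesis bounded_phi : forall k t j, hdom (phi k) (t, j) -> `|hval (phi k) t j| <= M.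
Hypothesis cvg_phi : graphical_cvg (fun k => set_valued (phi k)) L.
Hypothesis pert_dom : forall T k t j,
  hdom (pert T k) (t, j) <-> hdom (phi k) (t, j) /\ t + j%:R <= T.
Hypothesis pert_sol : forall eps T, 0 < eps -> 0 < T ->
  \forall k \near \oo, solution (inflation H eps) (pert T k).
Hypothesis pert_close : forall eta T, 0 < eta -> 0 < T -> \forall k \near \oo,
  forall t j, hdom (pert T k) (t, j) ->
    `|hval (pert T k) t j - hval (phi k) t j| <= eta.

Lemma pert_lipschitz : exists2 l, 0 <= l & forall T, 0 < T -> \forall k \near \oo,
  forall j s t, hdom (pert T k) (s, j) -> hdom (pert T k) (t, j) ->
    `|hval (pert T k) s j - hval (pert T k) t j| <= l * `|s - t|.
Proof.
have [l l0 lipl] := inflated_solution_lipschitz (M + 1) HBC.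
exists l => // T T0.
apply: filterS2 (pert_sol ltr01 T0) (pert_close ltr01 T0) => k sol close j s t Es Et.
apply: lipl sol _ Es Et => // r Er.
rewrite -(subrK (hval (phi k) r j) (hval (pert T k) r j)).
  rewrite (le_trans (ler_normD _ _))// addrC.
by rewrite lerD ?close//; have [/bounded_phi] := (pert_dom T k r j).1 Er.
Qed.

(** The perturbation need not be Lipschitz, only small; it is absorbed in
    [eta]. *)
Lemma tail_lipschitz l : (forall T, 0 < T -> \forall k \near \oo,
    forall j s t, hdom (pert T k) (s, j) -> hdom (pert T k) (t, j) ->
    `|hval (pert T k) s j - hval (pert T k) t j| <= l * `|s - t|) ->
  forall T eta, 0 < eta -> \forall k \near \oo,
  forall j s t, hdom (phi k) (s, j) -> hdom (phi k) (t, j) ->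
    s + j%:R <= T -> t + j%:R <= T ->
    `|hval (phi k) s j - hval (phi k) t j| <= l * `|s - t| + eta.
Proof.
move=> lip T eta eta0; pose T1 := Num.max T 1.
have T10 : 0 < T1 by rewrite lt_max ltr01 orbT.
have e20 : 0 < eta / 2 by rewrite divr_gt0.
apply: filterS2 (lip _ T10) (pert_close e20 T10) => k lipk close j s t Es Et sT tT.
have TT1 : T <= T1 by rewrite le_max lexx.
have Ps : hdom (pert T1 k) (s, j) by apply/pert_dom; split => //; exact: le_trans TT1.
have Pt : hdom (pert T1 k) (t, j) by apply/pert_dom; split => //; exact: le_trans TT1.
have := lipk _ _ _ Ps Pt; have := close _ _ Ps; have := close _ _ Pt.
set a := hval (phi k) s j; set b := hval (phi k) t j.
set a' := hval (pert T1 k) s j; set b' := hval (pert T1 k) t j => bb aa ab.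
have -> : a - b = (a' - b') - (a' - a) + (b' - b).
  by apply/rowP => i; rewrite !mxE; ring.
rewrite (le_trans (ler_normD _ _))// (splitr eta) addrA lerD//.
by rewrite (le_trans (ler_normB _ _))// lerD.
Qed.

Variable l : R.
Hypothesis l0 : 0 <= l.
Hypothesis pert_lip : forall T, 0 < T -> \forall k \near \oo,
  forall j s t, hdom (pert T k) (s, j) -> hdom (pert T k) (t, j) ->
    `|hval (pert T k) s j - hval (pert T k) t j| <= l * `|s - t|.

Notation xi := (limit_map L).

Let lip_phi := tail_lipschitz pert_lip.
Let xi_stair : staircase (hdom xi) := limit_dom_staircase stair_phi bounded_phi cvg_phi.
Let xi_value t j := @limit_value R n phi L l lip_phi cvg_phi t j (hval xi t j).
Let xi_lip := limit_map_lipschitz lip_phi cvg_phi.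

(** What is used of the convergence to treat flows: near any segment of the
    limit there is a solution of an inflated system, with inflation as small as
    desired, over a nearby segment and with nearby endpoints. The last bound
    keeps that whole solution close to the starting point of the segment. *)
Lemma limit_segment j r r' eta : hdom xi (r, j) -> hdom xi (r', j) -> r < r' ->
  0 < eta -> exists ph s s',
  [/\ solution (inflation H eta) ph, [/\ hdom ph (s, j), hdom ph (s', j) & s < s'],
      [/\ `|s - r| <= eta, `|s' - r'| <= eta, `|hval ph s j - hval xi r j| <= eta &
        `|hval ph s' j - hval xi r' j| <= eta],
      `|hval ph s' j - hval ph s j| <= l * (s' - s) &
      forall u, s <= u <= s' ->
        `|hval ph u j - hval xi r j| <= l * (r' - r) + (2 * l + 1) * eta].
Proof.
move=> Er Er' rr' eta0.
have r'0 : 0 <= r by exact: (stair_ge0 xi_stair Er).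
pose T := r' + 1 + j%:R.
have T0 : 0 < T by have j0 : 0 <= j%:R :> R by []; rewrite /T; lra.
have e20 : 0 < eta / 2 by rewrite divr_gt0.
have [s sr sE] := limit_dom_approx cvg_phi Er.
have [s' sr' sE'] := limit_dom_approx cvg_phi Er'.
have vs := xi_value (limit_mapP Er) sr sE.
have vs' := xi_value (limit_mapP Er') sr' sE'.
(* times converging to [r] and [r'] are eventually separated by the midpoint *)
have rm : r < (r + r') / 2 < r' by lra.
move: rm => /andP[rm mr].
near \oo => k.
have H1 : s k < (r + r') / 2 by near: k; exact: (cvgr_lt _ sr).
have H2 : (r + r') / 2 < s' k by near: k; exact: (cvgr_gt _ sr').
have H3 : s' k <= r' + 1 by near: k; apply: (cvgr_le _ sr'); rewrite ltrDl.
have E1 : hdom (phi k) (s k, j) by near: k.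
have E2 : hdom (phi k) (s' k, j) by near: k.
have P1 : hdom (pert T k) (s k, j).
  by apply/pert_dom; split => //; rewrite lerD2r; lra.
have P2 : hdom (pert T k) (s' k, j) by apply/pert_dom; split => //; rewrite lerD2r.
have d1 : `|s k - r| <= eta.
  by rewrite distrC; near: k; exact: ((cvgrPdist_le _ _).1 sr _ eta0).
have d2 : `|s' k - r'| <= eta.
  by rewrite distrC; near: k; exact: ((cvgrPdist_le _ _).1 sr' _ eta0).
have close : forall t j, hdom (pert T k) (t, j) ->
    `|hval (pert T k) t j - hval (phi k) t j| <= eta / 2.
  by near: k; exact: pert_close.
have lipk : forall j s t, hdom (pert T k) (s, j) -> hdom (pert T k) (t, j) ->
    `|hval (pert T k) s j - hval (pert T k) t j| <= l * `|s - t|.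
  by near: k; exact: pert_lip.
have v1 : `|hval (phi k) (s k) j - hval xi r j| <= eta / 2.
  by rewrite distrC; near: k; exact: ((cvgrPdist_le _ _).1 vs _ e20).
have v2 : `|hval (phi k) (s' k) j - hval xi r' j| <= eta / 2.
  by rewrite distrC; near: k; exact: ((cvgrPdist_le _ _).1 vs' _ e20).
have w1 : `|hval (pert T k) (s k) j - hval xi r j| <= eta.
  rewrite (splitr eta) (le_trans (ler_distD (hval (phi k) (s k) j) _ _))// lerD//.
  exact: close.
have sol : solution (inflation H eta) (pert T k) by near: k; exact: pert_sol.
exists (pert T k), (s k), (s' k); split => //.
- by split => //; lra.
- split => //.
  rewrite (splitr eta) (le_trans (ler_distD (hval (phi k) (s' k) j) _ _))// lerD//.
  exact: close.
- have := lipk _ _ _ P2 P1; rewrite (ger0_norm (_ : 0 <= s' k - s k))//.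
  by rewrite subr_ge0; lra.
- move=> u su; have [seg _ _] := solution_flow sol P1 P2 (lt_trans H1 H2).
  have := lipk _ _ _ (seg u su) P1.
  move: su => /andP[su us].
  rewrite (ger0_norm (_ : 0 <= u - s k)) ?subr_ge0// => lu.
  rewrite (le_trans (ler_distD (hval (pert T k) (s k) j) _ _))//.
  rewrite (le_trans (lerD lu w1))//.
  move: d1 d2; rewrite !ler_norml => /andP[d1 d1'] /andP[d2 d2'].
  have : l * (u - s k) <= l * (r' - r + 2 * eta) by rewrite ler_wpM2l//; lra.
  lra.
Unshelve. all: by end_near. Qed.


(** The approximating solution is in the inflated flow set at almost every time
    of a short segment, and the whole segment stays near the limit at [r]. *)
Lemma limit_flow_set j r t : hdom xi (r, j) -> hdom xi (t, j) -> r < t ->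
  flow_set H (hval xi r j).
Proof.
move=> Er Et rt; have [[cC _] _ _ _ _] := HBC.
have t0 : 0 < t - r by rewrite subr_gt0.
apply: (closed_approx_mem cC) => e e0.
have l1 : 0 < l + 1 by rewrite ltr_wpDl.
pose h := Num.min (t - r) (e / 2 / (l + 1)).
have h0 : 0 < h by rewrite lt_min t0 !divr_gt0.
have lh : l * h <= e / 2.
  have : h * (l + 1) <= e / 2 by rewrite -ler_pdivlMr// ge_min lexx orbT.
  by rewrite mulrDr mulr1 mulrC; lra.
have l2 : 0 < 2 * l + 2 by lra.
pose eta := e / 2 / (2 * l + 2).
have eta0 : 0 < eta by rewrite !divr_gt0.
have leta : (2 * l + 2) * eta = e / 2 by rewrite /eta mulrC divfK// gt_eqF.
have Eh : hdom xi (r + h, j).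
  apply: (stair_convex xi_stair Er Et); rewrite lerDl (ltW h0)/= -lerBrDl.
  by rewrite ge_min lexx.
have [|ph [s [s' [sol [P1 P2 ss'] _ _ near_xi]]]] := limit_segment Er Eh _ eta0.
  by rewrite ltrDl.
have [_ _ ae] := solution_flow sol P1 P2 ss'.
have [u su [[y Cy [b be ybE]] _ _]] := ae_exists ss' ae.
exists y => //.
rewrite (le_trans (ler_distD (hval ph u j) _ _))//.
have yu : `|y - hval ph u j| <= eta.
  rewrite -ybE opprD addrA subrr sub0r normrN.
  exact: le_trans (norm_le_enorm _) be.
have := lerD yu (near_xi u su); rewrite [r + h - r]addrC addKr => /le_trans; apply.
lra.
Qed.

(** The step [h] is chosen first, so that the approximating solution stays
    where its velocities are within [rho] of [F x]; the inflation [eta] is chosen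
    next, small with respect to [h], so that the derivative differs from the
    difference quotient of the approximating solution by at most [2 rho]. The
    closure in the mean value inclusion costs the fourth [rho]. *)
Lemma limit_flow_map j r t : hdom xi (r, j) -> hdom xi (t, j) -> r < t ->
  derivable (fun u => hval xi u j) r 1 ->
  flow_map H (hval xi r j) (derive1 (fun u => hval xi u j) r).
Proof.
move=> Er Et rt dr; have Cr := limit_flow_set Er Et rt.
have [_ [oscF _] _ CF _] := HBC; have [_ cF] := CF _ Cr.
apply: (osc_approx_mem oscF) => e e0; exists (hval xi r j).
set x := hval xi r j; set v := derive1 _ r.
suff : fattening (flow_map H x) e v.
  move=> [w Fw vw]; exists w; split => //; last by rewrite distrC.
  by rewrite subrr normr0 ltW.
pose rho := e / 4.
have rho0 : 0 < rho by rewrite divr_gt0.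
have [eta1 eta10 Fnear] := inflation_flow_map_near HBC Cr rho0.
have [d d0 dexp] := derivable_expansion dr rho0.
have t0 : 0 < t - r by rewrite subr_gt0.
have l1 : 0 < l + 1 by rewrite ltr_wpDl.
(* the three bounds keep [r + h] in the domain, make the expansion of [xi] at
   [r] valid, and keep the velocities within reach of [Fnear] *)
pose h := Num.min (t - r) (Num.min (d / 2) (eta1 / 2 / (l + 1))).
have h0 : 0 < h by rewrite !lt_min t0 !divr_gt0.
have lh : l * h <= eta1 / 2.
  have : h * (l + 1) <= eta1 / 2 by rewrite -ler_pdivlMr// !ge_min lexx !orbT.
  by rewrite mulrDr mulr1 mulrC; lra.
have hd : h < d.
  have : h <= d / 2 by rewrite !ge_min lexx orbT.
  by move=> /le_lt_trans; apply; lra.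
have Eh : hdom xi (r + h, j).
  apply: (stair_convex xi_stair Er Et); rewrite lerDl (ltW h0)/= -lerBrDl.
  by rewrite ge_min lexx.
have l2 : 0 < 2 * l + 2 by lra.
pose eta := Num.min (eta1 / 2 / (2 * l + 2)) (rho * h / (2 * l + 2)).
have eta0 : 0 < eta by rewrite lt_min !divr_gt0 ?mulr_gt0.
have leta : (2 * l + 2) * eta <= eta1 / 2.
  by rewrite mulrC -ler_pdivlMr// ge_min lexx.
have leta' : (2 * l + 2) * eta <= rho * h.
  by rewrite mulrC -ler_pdivlMr// ge_min lexx orbT.
have leta0 : 0 <= l * eta by rewrite mulr_ge0// ltW.
have [|ph [s [s' [sol [P1 P2 ss'] [ds ds' dv dv'] lipq near_xi]]]] :=
    limit_segment Er Eh _ eta0.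
  by rewrite ltrDl.
set A := hval ph s' j - hval ph s j in lipq.
have ss0 : 0 < s' - s by rewrite subr_gt0.
have qF : fattening (flow_map H x) (rho + rho) ((s' - s)^-1 *: A).
  apply: fatteningD; apply: closure_fattening => //.
  apply: (solution_mean_value sol P1 P2 ss').
    exact: convex_fattening.
  move=> u su w Fw; apply: Fnear Fw; first by lra.
  apply: le_trans (near_xi u su) _; rewrite [r + h - r]addrC addKr; lra.
pose q := (s' - s)^-1 *: A.
have AE : A = (s' - s) *: q by rewrite /q scalerKV// gt_eqF.
have ql : `|q| <= l.
  by rewrite normrZ gtr0_norm ?invr_gt0// ler_pdivrMl// mulrC.
have e4 : e = (rho + rho) + (rho + rho) by rewrite /rho; lra.
rewrite e4; apply: fatteningD; exists q => //.
(* both [h *: v] and [h *: q] are close to the increment of [xi] over [h] *)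
have hv : `|h *: v - h *: q| <= h * (rho + rho).
  have := dexp (r + h); rewrite [r + h - r]addrC addKr (gtr0_norm h0) => /(_ hd).
  rewrite -/x -/v => H1.
  set B := hval xi (r + h) j - x in H1.
  have AB : `|A - B| <= 2 * eta.
    have -> : A - B = (hval ph s' j - hval xi (r + h) j) - (hval ph s j - x).
      by apply/rowP => i; rewrite !mxE; ring.
    by rewrite (le_trans (ler_normB _ _))//; lra.
  have sh : `|s' - s - h| <= 2 * eta.
    have -> : s' - s - h = (s' - (r + h)) - (s - r) by ring.
    by rewrite (le_trans (ler_normB _ _))//; lra.
  have -> : h *: v - h *: q = (s' - s - h) *: q - (B - h *: v) - (A - B).
    by rewrite [in RHS]AE; apply/rowP => i; rewrite !mxE; ring.
  have qle : `|(s' - s - h) *: q| <= 2 * eta * l by rewrite normrZ ler_pM.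
  rewrite (le_trans (ler_normB _ _))// -lerBrDr (le_trans (ler_normB _ _))//.
  lra.
rewrite -scalerBr normrZ (gtr0_norm h0) in hv.
by move: hv; rewrite ler_pM2l.
Qed.


(** The jump times of the approximations are squeezed between times converging
    to [t] from the sections [j] and [j.+1], so the states before and after the
    jump converge to those of the limit. *)
Lemma limit_jump t j : hdom xi (t, j) -> hdom xi (t, j.+1) ->
  jump_set H (hval xi t j) /\ jump_map H (hval xi t j) (hval xi t j.+1).
Proof.
move=> Et Et1; have [[_ cD] _ [oscG _] _ _] := HBC.
have [s st sE] := limit_dom_approx cvg_phi Et.
have [s' st' sE'] := limit_dom_approx cvg_phi Et1.
have t0 : 0 <= t by exact: (stair_ge0 xi_stair Et).
have /choice[r rP] : forall k, exists r,
    hdom (phi k) (s k, j) -> hdom (phi k) (s' k, j.+1) ->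
    [/\ s k <= r, r <= s' k, hdom (phi k) (r, j) & hdom (phi k) (r, j.+1)].
  move=> k; have [H1|] := pselect (hdom (phi k) (s' k, j.+1)); last by exists 0.
  have [r [rs r1 r2]] := stair_step (stair_phi k) H1; exists r => Es _; split => //.
  exact: (stair_mono (stair_phi k) Es r2).
have rE : \forall k \near \oo, [/\ s k <= r k, r k <= s' k,
    hdom (phi k) (r k, j) & hdom (phi k) (r k, j.+1)].
  by apply: filterS2 sE sE' => k; exact: rP.
have rt : r @ \oo --> t.
  apply: squeeze_cvgr st st'; apply: filterS rE => k [-> ->] //.
have v0 : (fun k => hval (phi k) (r k) j) @ \oo --> hval xi t j.
  by apply: xi_value (limit_mapP Et) rt _; apply: filterS rE => k [].
have v1 : (fun k => hval (phi k) (r k) j.+1) @ \oo --> hval xi t j.+1.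
  by apply: xi_value (limit_mapP Et1) rt _; apply: filterS rE => k [].
have approx e : 0 < e -> exists y w, [/\ jump_set H y, jump_map H y w,
    `|y - hval xi t j| <= e & `|w - hval xi t j.+1| <= e].
  move=> e0; have e30 : 0 < e / 3 by rewrite divr_gt0.
  pose T := t + 1 + j.+1%:R.
  have T0 : 0 < T by rewrite /T; have : 0 <= j.+1%:R :> R by []; lra.
  near \oo => k.
  have r1 : r k <= t + 1 by near: k; apply: (cvgr_le _ rt); rewrite ltrDl.
  have [_ _ E1 E2] : [/\ s k <= r k, r k <= s' k,
    hdom (phi k) (r k, j) & hdom (phi k) (r k, j.+1)] by near: k.
  have P1 : hdom (pert T k) (r k, j).
    by apply/pert_dom; split => //; rewrite lerD// ler_nat.
  have P2 : hdom (pert T k) (r k, j.+1).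
    by apply/pert_dom; split => //; rewrite lerD.
  have close : forall t j, hdom (pert T k) (t, j) ->
      `|hval (pert T k) t j - hval (phi k) t j| <= e / 3.
    by near: k; exact: pert_close.
  have w0 : `|hval (phi k) (r k) j - hval xi t j| <= e / 3.
    by rewrite distrC; near: k; exact: ((cvgrPdist_le _ _).1 v0 _ e30).
  have w1 : `|hval (phi k) (r k) j.+1 - hval xi t j.+1| <= e / 3.
    by rewrite distrC; near: k; exact: ((cvgrPdist_le _ _).1 v1 _ e30).
  have [_ _ _ jump] : solution (inflation H (e / 3)) (pert T k).
    by near: k; exact: pert_sol.
  have [_ [w [y [[_ -> [c ce ycE]] Dy] Gyw] [b be wbE]]] := jump _ _ P1 P2.
  exists y, w; split => //.
  - have : `|y - hval (pert T k) (r k) j| <= e / 3.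
      by rewrite -ycE addrC addKr (le_trans (norm_le_enorm _)).
    have := close _ _ P1.
    have := ler_distD (hval (pert T k) (r k) j) y (hval xi t j).
    have := ler_distD (hval (phi k) (r k) j) (hval (pert T k) (r k) j) (hval xi t j).
    lra.
  - have : `|w - hval (pert T k) (r k) j.+1| <= e / 3.
      by rewrite -wbE opprD addrA subrr sub0r normrN (le_trans (norm_le_enorm _)).
    have := close _ _ P2.
    have := ler_distD (hval (pert T k) (r k) j.+1) w (hval xi t j.+1).
    have := ler_distD (hval (phi k) (r k) j.+1) (hval (pert T k) (r k) j.+1)
      (hval xi t j.+1).
    lra.
split.
  apply: (closed_approx_mem cD) => e e0.
  by have [y [w [Dy _ yt _]]] := approx e e0; exists y.
apply: (osc_approx_mem oscG) => e e0.
by have [y [w [_ Gyw yt wt]]] := approx e e0; exists y, w.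
Unshelve. all: by end_near. Qed.

Lemma limit_initial : (flow_set H `|` jump_set H) (hval xi 0 0).
Proof.
have [[cC cD] _ _ _ _] := HBC.
have E0 := stair0 xi_stair.
have v0 : (fun k => hval (phi k) 0 0%N) @ \oo --> hval xi 0 0.
  apply: xi_value (limit_mapP E0) (cvg_cst _) _.
  by near=> k; exact: (stair0 (stair_phi k)).
apply: (closed_approx_mem (closedU cC cD)) => e e0.
have e30 : 0 < e / 3 by rewrite divr_gt0.
near \oo => k.
have P0 : hdom (pert 1 k) (0, 0%N).
  by apply/pert_dom; rewrite addr0; split => //; exact: (stair0 (stair_phi k)).
have close : forall t j, hdom (pert 1 k) (t, j) ->
    `|hval (pert 1 k) t j - hval (phi k) t j| <= e / 3.
  by near: k; exact: pert_close.
have w0 : `|hval (phi k) 0 0 - hval xi 0 0| <= e / 3.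
  by rewrite distrC; near: k; exact: ((cvgrPdist_le _ _).1 v0 _ e30).
have [_ init _ _] : solution (inflation H (e / 3)) (pert 1 k).
  by near: k; exact: pert_sol.
have [y CDy yph] : exists2 y, (flow_set H `|` jump_set H) y &
    `|y - hval (pert 1 k) 0 0| <= e / 3.
  case: init => -[y Ay [b be <-]]; exists y; rewrite ?opprD ?addrA ?subrr ?sub0r ?normrN.
  - by left.
  - by rewrite (le_trans (norm_le_enorm _)).
  - by right.
  - by rewrite (le_trans (norm_le_enorm _)).
exists y => //.
have := close _ _ P0.
have := ler_distD (hval (pert 1 k) 0 0) y (hval xi 0 0).
have := ler_distD (hval (phi k) 0 0) (hval (pert 1 k) 0 0) (hval xi 0 0).
lra.
Unshelve. all: by end_near. Qed.

Lemma limit_flow_ae j t t' : t < t' -> `[t, t'] `*` [set j] `<=` hdom xi ->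
  {ae mu, forall r : R, r \in `[t, t'] ->
    [/\ flow_set H (hval xi r j), derivable (fun u => hval xi u j) r 1
      & flow_map H (hval xi r j) (derive1 (fun u => hval xi u j) r)]}.
Proof.
move=> tt' seg.
have E r : t <= r <= t' -> hdom xi (r, j) by move=> rt; apply: seg; rewrite /= in_itv.
have der i : {ae mu, forall r, t < r < t' -> derivable (fun u => hval xi u j ord0 i) r 1}.
  apply: (@lipschitz_ae_derivable R _ l) => x y xt yt.
  apply: le_trans (xi_lip (E _ xt) (E _ yt)).
  by have := entry_le_norm (hval xi x j - hval xi y j) i; rewrite !mxE.
have ends : {ae mu, forall r, r != t /\ r != t'}.
  have null x : mu.-negligible [set x].
    by exists [set x]; split => //; exact: lebesgue_measure_set1.
  apply: negligibleS (negligibleU (null t) (null t')) => r /= /not_andP.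
  by move=> [|] /negP; rewrite negbK => /eqP ->; [left|right].
have Fae := ae_filter_ringOfSetsType mu.
have derall : {ae mu, forall r, forall i, t < r < t' ->
    derivable (fun u => hval xi u j ord0 i) r 1}.
  exact: filter_forall.
apply: filterS2 derall ends => r dr [rt rt']; rewrite in_itv/= => /andP[tr rt'2].
have {}tr : t < r by rewrite lt_neqAle eq_sym rt.
have {}rt' : r < t' by rewrite lt_neqAle rt'.
have Er : hdom xi (r, j) by apply: E; rewrite !ltW.
have Et' : hdom xi (t', j) by apply: E; rewrite lexx ltW.
have dxi : derivable (fun u => hval xi u j) r 1.
  by apply/derivable_mxP => i i'; rewrite ord1; apply: dr; rewrite tr.
split => //; first exact: limit_flow_set Er Et' rt'.
exact: limit_flow_map Er Et' rt' dxi.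
Qed.

Lemma limit_solution : solution H xi.
Proof.
split.
- exact: (limit_map_arc stair_phi unbounded_phi bounded_phi lip_phi cvg_phi).
- exact: limit_initial.
- exact: limit_flow_ae.
- by move=> j t; exact: limit_jump.
Qed.

End limit_solution.

(** * Tails of a vanishing inflation solution *)

Lemma vanishing_perturbation_small (R : realType) n (psi : hybrid_map R n) chi :
  vanishing_perturbation psi chi -> forall eta T : R, 0 < eta -> 0 < T ->
  exists K : R, forall s i t j, hdom psi (s, i) -> K < s + i%:R ->
    0 <= t -> hdom psi (s + t, (i + j)%N) -> t + j%:R <= T ->
    `|chi s i (s + t) (i + j)%N| <= eta.
Proof.
move=> [_ vanish] eta T eta0 T0.
have small : nbhs 0%E [set x : \bar R | (x < eta%:E)%E].
  apply: open_nbhs_nbhs; split; last by rewrite /= lte_fin.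
  exact: open_ereal_lt_ereal.
have [K _ KP] := vanish T T0 _ small.
exists K => s i t j Esi Ks t0 Et tT.
apply: le_trans (norm_le_enorm _) _; rewrite -lee_fin.
apply: le_trans (ltW (KP (s, i) (conj Esi Ks))).
apply: ereal_sup_ubound; exists (s + t, (i + j)%N) => //=.
have -> : s + t + (i + j)%:R - (s + i%:R) = t + j%:R by rewrite natrD; ring.
have tj0 : 0 <= t + j%:R by rewrite addr_ge0.
split; last by rewrite tj0.
by split => //=; rewrite natrD; move: tj0; lra.
Qed.

Theorem proposition4p7 (R : realType) (n : nat) (H : hybrid_data R n)
    (HBC : hybrid_basic_conditions H) (psi : hybrid_map R n)
    (hpsi : vanishing_inflation_solution H psi) :
  asymptotic_solution H psi.
Proof.
have [[curve ac] complete bounded [chi vanish inflated]] := hpsi.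
split => // t j L tjE tjoo cvgL.
have stair := hybrid_time_domain_staircase curve.1.
pose phi k := tail psi (t k) (j k).
pose pert T k := perturbed_tail psi chi T (t k) (j k).
have stair_phi k : staircase (hdom (phi k)) by exact: staircase_tail.
have unbounded_phi k : unbounded_time (hdom (phi k)) by exact: unbounded_time_tail.
have [M bounded_phi] : exists M, forall k u i, hdom (phi k) (u, i) ->
    `|hval (phi k) u i| <= M.
  have [B [_ BP]] := bounded; exists (`|B| + 1) => k u i [_ Eu].
  by apply: (BP _ _ _ Eu); rewrite (le_lt_trans (ler_norm _))// ltrDl.
have late (K : R) : \forall k \near \oo, K < t k + (j k)%:R.
  exact: ((cvgryPgt _).1 tjoo K).
have pert_dom T k u i : hdom (pert T k) (u, i) <-> hdom (phi k) (u, i) /\ u + i%:R <= T.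
  by split=> [[? []]//|[[? ?] ?]]; split.
have pert_sol eps T : 0 < eps -> 0 < T ->
    \forall k \near \oo, solution (inflation H eps) (pert T k).
  move=> e0 T0; have [K K0 KP] := inflated eps T e0 T0.
  by apply: filterS (late K) => k /ltW; exact: KP.
have pert_close eta T : 0 < eta -> 0 < T -> \forall k \near \oo, forall u i,
    hdom (pert T k) (u, i) -> `|hval (pert T k) u i - hval (phi k) u i| <= eta.
  move=> eta0 T0; have [K KP] := vanishing_perturbation_small vanish eta0 T0.
  apply: filterS (late K) => k Kk u i [[u0 Eu] [_ uT]].
  by rewrite /= addrC addKr; exact: KP.
have [l l0 pert_lip] := pert_lipschitz HBC bounded_phi pert_dom pert_sol pert_close.
have lip_phi := tail_lipschitz pert_dom pert_close pert_lip.
exists (limit_map L); split.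
- exact: (limit_solution HBC stair_phi unbounded_phi bounded_phi cvgL pert_dom
    pert_sol pert_close l0 pert_lip).
- exact: (limit_dom_unbounded stair_phi unbounded_phi bounded_phi cvgL).
- exact: (set_valued_limit_map lip_phi cvgL).
Qed.
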